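(* Let $\mathfrak{C}$ be a typical circuit class. The following statements are equivalent: 1. There are $\mathsf{P}$-natural proofs useful against $\mathfrak{C}[\mathsf{poly}(n)]$. 2. There are $\mathsf{ZPP}$-natural proofs useful against $\mathfrak{C}[\mathsf{poly}(n)]$. 3. For each $\varepsilon>0$, there are $\mathsf{DTIME}(O(2^{(\log N)^{\varepsilon}}))$-natural proofs useful against $\mathfrak{C}[\mathsf{poly}(n)]$, where $N=2^n$ is the truth-table size. 4. For each $\varepsilon>0$, there are zero-error complexity distinguishers for $\mathfrak{C}[\mathsf{poly}(n)]$ running in time $O(2^{n^{\varepsilon}})$.
   Context: A circuit class $\mathfrak{C}$ is typical if it is one of $\mathsf{AC}^0$, $\mathsf{AC}^0[p]$ ($p$ a fixed prime), $\mathsf{ACC}^0$, $\mathsf{TC}^0$, $\mathsf{NC}^1$, $\mathsf{Formula}$, $\mathsf{Circuit}$. $\mathfrak{C}[s(n)]$ denotes $n$-variable $\mathfrak{C}$-circuits of size (number of wires) at most $s(n)$; statements about $\mathfrak{C}[\mathsf{poly}(n)]$ mean they hold for $\mathfrak{C}[n^k]$ for every $k\ge1$. $\mathcal{F}_n$ is the set of Boolean functions on $n$ bits, viewed as truth tables of length $N=2^n$. A combinatorial property is $\mathfrak{R}=\{\mathcal{R}_n\}$ with $\mathcal{R}_n\subseteq\mathcal{F}_n$; $L_{\mathfrak{R}}$ is the language of truth tables of functions in $\bigcup_n\mathcal{R}_n$. For a complexity class $\mathfrak{D}$, $\mathfrak{R}$ is a $\mathfrak{D}$-natural property useful against $\mathfrak{C}[s(n)]$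 if for some $n_0$: $L_{\mathfrak{R}}\in\mathfrak{D}$; for all $n\ge n_0$, $\Pr_{f\sim\mathcal{F}_n}[f\in\mathcal{R}_n]\ge1/2$; and for all $n\ge n_0$, $\mathcal{R}_n\cap\mathfrak{C}[s(n)]=\emptyset$. ''There are $\mathfrak{D}$-natural proofs useful against $\mathfrak{C}[s]$'' means such a property exists. A zero-error complexity distinguisher for $\mathfrak{C}[s(n)]$ running in time $T$ is a probabilistic oracle algorithm $A^g$ such that $A^g(1^n)$ always halts within time $T(n)$ with output in $\{0,1,?\}$; if $g\in\mathfrak{C}[s(n)]$ then $A^g(1^n)$ always outputs $0$ or $?$ and outputs $?$ with probability $\le1/3$; and for every $n$ there is $\mathcal{S}_n\subseteq\mathcal{F}_n$ with $|\mathcal{S}_n|/|\mathcal{F}_n|\ge1-o(1)$ such that for every $f\in\mathcal{S}_n$, $A^f(1^n)$ always outputs $1$ or $?$ and outputs $?$ with probability $\le1/3$. *)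

(* Defs.v *)
From HB Require Import structures.
From mathcomp Require Import all_boot all_order all_algebra.
From mathcomp Require Import all_classical all_reals all_analysis.

Set Implicit Arguments.
Unset Strict Implicit.
Unset Printing Implicit Defensive.

Import Order.TTheory GRing.Theory Num.Theory.

Local Open Scope nat_scope.

Notation bfun n := {ffun n.-tuple bool -> bool}.

(* The least significant bit comes first. *)
Definition bits (n i : nat) : n.-tuple bool :=
  [tuple odd (i %/ 2 ^ j) | j < n].

Definition truth_table (n : nat) (f : bfun n) : seq bool :=
  [seq f (bits n i) | i <- iota 0 (2 ^ n)].

Inductive gate := NOT | AND | OR | MOD of nat | MAJ.

Definition gate_eval (g : gate) (v : seq bool) : bool :=
  match g with
  | NOT => ~~ head false v
  | AND => all id v
  | OR => has id v
  | MOD m => ~~ (m %| count id v)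
  | MAJ => size v <= (count id v).*2
  end.

Inductive node (n : nat) :=
  | Input of 'I_n
  | Constant of bool
  | Gate of gate & seq nat.

Arguments Input {n} _.
Arguments Constant {n} _.
Arguments Gate {n} _ _.

(* A circuit is the list of its nodes in topological order: the wires entering
   a gate are given by the positions of earlier nodes (a node may be repeated),
   and the output node is the last one. *)
Definition circuit (n : nat) := seq (node n).

Section Circuits.
Variable n : nat.
Implicit Type C : circuit n.

Definition fanin (nd : node n) : seq nat :=
  if nd is Gate _ args then args else [::].

Definition well_formed C : bool :=
  (0 < size C) &&
  [forall i : 'I_(size C),
     all (fun j => j < i) (fanin (nth (Constant false) C i))].

Definition node_eval (x : n.-tuple bool) (vals : seq bool) (nd : node n) :=
  match nd with
  | Input i => tnth x i
  | Constant b => b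
  | Gate g args => gate_eval g [seq nth false vals j | j <- args]
  end.

Definition circuit_eval C (x : n.-tuple bool) : bool :=
  last false (foldl (fun vals nd => rcons vals (node_eval x vals nd)) [::] C).

Definition size_wires C : nat := sumn [seq size (fanin nd) | nd <- C].

Definition node_depth (ds : seq nat) (nd : node n) : nat :=
  if nd is Gate _ args then (\max_(j <- args) nth 0 ds j).+1 else 0.

Definition depth C : nat :=
  last 0 (foldl (fun ds nd => rcons ds (node_depth ds nd)) [::] C).

(* No node feeds two wires; an input variable may still be read several times,
   through several [Input] nodes. *)
Definition is_formula C : bool := uniq (flatten [seq fanin nd | nd <- C]).

End Circuits.

Inductive typical_class :=
  | AC0
  | AC0p (p : nat) of prime p
  | ACC0
  | TC0
  | NC1
  | Formula
  | Circuit.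

Definition bounded_fanin (K : typical_class) : bool :=
  match K with NC1 | Formula | Circuit => true | _ => false end.

(* [c] is the constant hidden in the name of the class: the depth is at most
   [c] for the constant-depth classes and at most [c * log n] for NC1, and the
   moduli of an ACC0 circuit are at most [c].  It plays no role for [Formula]
   and [Circuit]. *)
Definition gate_allowed (K : typical_class) (c : nat) (g : gate) (k : nat) :=
  match g with
  | NOT => k == 1
  | AND | OR => bounded_fanin K ==> (k == 2)
  | MOD m =>
      match K with
      | @AC0p p _ => m == p
      | ACC0 => 1 < m <= c
      | _ => false
      end
  | MAJ => if K is TC0 then true else false
  end.

Definition node_allowed (K : typical_class) (c n : nat) (nd : node n) : bool :=
  if nd is Gate g args then gate_allowed K c g (size args) else true.

Definition shape_allowed (K : typical_class) (c n : nat) (C : circuit n) :=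
  match K with
  | AC0 | AC0p _ _ | ACC0 | TC0 => depth C <= c
  | NC1 => depth C <= c * up_log 2 n
  | Formula => is_formula C
  | Circuit => true
  end.

Definition computable_in (K : typical_class) (c s n : nat) (f : bfun n) :=
  exists C : circuit n,
    [/\ well_formed C, all (@node_allowed K c n) C, shape_allowed K c C,
        size_wires C <= s & forall x, circuit_eval C x = f x].

(* Unit-cost RAM with addition and truncated subtraction, written as a
   structured program.  Registers and heap cells hold natural numbers; the
   input string and the oracle (the truth table of a Boolean function) are read
   by random access.  Without multiplication, numbers have at most t + O(1)
   bits after t steps, so the model is polynomially equivalent to Turing
   machines. *)
Inductive program :=
  | Skip
  | Assign (x k : nat)
  | Add (x y z : nat)
  | Sub (x y z : nat)
  | HeapGet (x y : nat)
  | HeapSet (x y : nat)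
  | Read (x y : nat)
  | Query (x y : nat)
  | Toss (x : nat)
  | Seq (p q : program)
  | If (x : nat) (p q : program)
  | While (x : nat) (p : program).

Fixpoint toss_free (p : program) : bool :=
  match p with
  | Toss _ => false
  | Seq p q | If _ p q => toss_free p && toss_free q
  | While _ p => toss_free p
  | _ => true
  end.

Record state := State { regs : nat -> nat; heap : nat -> nat; coins : seq bool }.

Definition set_reg (s : state) (x v : nat) : state :=
  State [eta regs s with x |-> v] (heap s) (coins s).

(* The end marker 2 lets a machine find the length of its input in logarithmic
   time, as needed for the sublinear time bounds. *)
Definition cell (w : seq bool) (i : nat) : nat :=
  if i < size w then nat_of_bool (nth false w i) else 2.

(* The first component is the stack of programs still to be run. *)
Definition config := (seq program * state)%type.

Definition step (input oracle : seq bool) (cf : config) : config :=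
  let: (k, s) := cf in
  let r := regs s in
  if k isn't p :: k' then cf else
  match p with
  | Skip => (k', s)
  | Assign x v => (k', set_reg s x v)
  | Add x y z => (k', set_reg s x (r y + r z))
  | Sub x y z => (k', set_reg s x (r y - r z))
  | HeapGet x y => (k', set_reg s x (heap s (r y)))
  | HeapSet x y => (k', State r [eta heap s with r x |-> r y] (coins s))
  | Read x y => (k', set_reg s x (cell input (r y)))
  | Query x y => (k', set_reg s x (cell oracle (r y)))
  | Toss x => (k', State [eta r with x |-> nat_of_bool (head false (coins s))]
                         (heap s) (behead (coins s)))
  | Seq p q => ([:: p, q & k'], s)
  | If x p q => ((if r x != 0 then p else q) :: k', s)
  | While x q => ((if r x != 0 then [:: q, p & k'] else k'), s)
  end.

Definition run (M : program) (input oracle tosses : seq bool) (t : nat) :=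
  iter t (step input oracle)
       ([:: M], State (fun=> 0) (fun=> 0) tosses).

Definition halted (cf : config) : bool := nilp cf.1.

(* The output is in register 0; [None] is the output "?". *)
Definition output (cf : config) : option bool :=
  match regs cf.2 0 with 0 => Some false | 1 => Some true | _ => None end.

(* A machine that halts within [T] steps tosses at most [T] coins, so its coin
   tosses are a uniform element of [T.-tuple bool]. *)
Definition halts_within (M : program) (input oracle : seq bool) (T : nat) :=
  forall r : T.-tuple bool, halted (run M input oracle r T).

Definition Pr (T : finType) (A : pred T) : rat := (#|A|%:R / #|{: T}|%:R)%R.

Definition zero_error_output (M : program) (input oracle : seq bool) (T : nat)
    (b : bool) : Prop :=
  (forall r : T.-tuple bool,
     let o := output (run M input oracle r T) in o = Some b \/ o = None) /\
  (Pr [pred r : T.-tuple bool | output (run M input oracle r T) == None]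
     <= 1 / 3%:R)%R.

Definition language := seq bool -> Prop.

Definition DTIME (T : nat -> nat) (L : language) : Prop :=
  exists2 M : program, toss_free M &
    forall w : seq bool,
      let cf := run M w [::] [::] (T (size w)) in
      halted cf /\ output cf = Some `[< L w >].

Definition ZPTIME (T : nat -> nat) (L : language) : Prop :=
  exists M : program, forall w : seq bool,
    halts_within M w [::] (T (size w)) /\
    zero_error_output M w [::] (T (size w)) `[< L w >].

Definition P (L : language) : Prop := exists k, DTIME (fun N => N ^ k + k) L.

Definition ZPP (L : language) : Prop := exists k, ZPTIME (fun N => N ^ k + k) L.

Section RealTimeBounds.
Variable R : realType.
Local Open Scope ring_scope.

Definition big_O (T : nat -> nat) (t : nat -> R) : Prop :=
  exists c : R, forall n, (T n)%:R <= c * t n.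

Definition DTIME_O (t : nat -> R) (L : language) : Prop :=
  exists2 T : nat -> nat, big_O T t & DTIME T L.

Definition log2 (x : R) : R := ln x / ln 2%:R.

End RealTimeBounds.

Definition property := forall n, {set bfun n}.

Definition property_language (Rn : property) : language :=
  fun w => exists n (f : bfun n), f \in Rn n /\ w = truth_table f.

Definition natural_property (D : language -> Prop) (K : typical_class)
    (c : nat) (s : nat -> nat) (Rn : property) : Prop :=
  exists n0 : nat,
    [/\ D (property_language Rn),
        forall n, n0 <= n -> (1 / 2%:R <= Pr [pred f | f \in Rn n])%R &
        forall n, n0 <= n ->
          forall f, f \in Rn n -> ~ computable_in K c (s n) f].

(* Usefulness against K[poly(n)] means usefulness against K[n^k] for every k,
   and, for classes whose name hides a constant, for every value of it. *)
Definition natural_proofs_poly (D : language -> Prop) (K : typical_class) :=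
  forall c k : nat, 0 < k ->
    exists Rn : property, natural_property D K c (fun n => n ^ k) Rn.

Definition zero_error_distinguisher (K : typical_class) (c : nat)
    (s T : nat -> nat) (A : program) : Prop :=
  [/\ forall n (g : bfun n),
        halts_within A (nseq n true) (truth_table g) (T n),
      forall n (g : bfun n), computable_in K c (s n) g ->
        zero_error_output A (nseq n true) (truth_table g) (T n) false &
      exists S : property,
        (forall delta : rat, 0 < delta -> exists n1, forall n, (n1 <= n)%N ->
           1 - delta <= Pr [pred f | f \in S n])%R /\
        (forall n (f : bfun n), f \in S n ->
           zero_error_output A (nseq n true) (truth_table f) (T n) true)].

Definition distinguishers_poly (R : realType) (t : nat -> R)
    (K : typical_class) : Prop :=
  forall c k : nat, 0 < k ->
    exists (A : program) (T : nat -> nat),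
      big_O T t /\ zero_error_distinguisher K c (fun n => n ^ k) T A.

(* Main.v *)
Require Import Defs.
From mathcomp Require Import all_boot all_order all_algebra.
From mathcomp Require Import all_classical all_reals all_analysis.
From mathcomp Require Import zify lra.

(* A zero-error machine M that accepts no easy function on m variables, but most
   random ones with probability 2/3, can be derandomized by the truth table that
   it is given.  Let m be about n^(1/a), and cut the truth table of a function f
   on n variables into blocks of length 2^O(m).  The first 2^m bits of a block
   are the truth table of a restriction of f, which is easy if f is; the next
   bits serve as the coin tosses of M on this restriction.  For a random f the
   blocks are independent, and each makes M accept with probability at least
   1/2 * 2/3, so m blocks all fail with probability at most (2/3)^m.  Running M
   on m blocks is deterministic, takes time 2^O(m) = O(2^(n^eps)), and needs
   only random access to the truth table, which may thus be the input of a
   natural property or the oracle of a distinguisher.  Such a machine M comes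
   from ZPP-natural proofs as well as from distinguishers (with eps = 1), whence
   2 => 3 and 4 => 3.  Finally 3 => 1 is the case eps = 1, 1 => 2 holds since a
   deterministic machine never errs, and 3 => 4 goes through 1 and 2. *)

Set Implicit Arguments.
Unset Strict Implicit.
Unset Printing Implicit Defensive.

Import Order.TTheory GRing.Theory Num.Theory.

Local Open Scope nat_scope.

(** * Truth tables and restrictions *)

Lemma eq_binary_digits n i k : i < 2 ^ n -> k < 2 ^ n ->
  (forall j, j < n -> odd (i %/ 2 ^ j) = odd (k %/ 2 ^ j)) -> i = k.
Proof.
elim: n i k => [|n IHn] i k; first by rewrite expn0 !ltnS !leqn0 => /eqP-> /eqP->.
rewrite expnS => ltin ltkn eq_ik.
rewrite -(odd_double_half i) -(odd_double_half k).
have := eq_ik 0 isT; rewrite !divn1 => ->; congr (_ + _.*2).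
apply: IHn => [||j ltjn]; try by lia.
by have := eq_ik j.+1 ltjn; rewrite expnS !divnMA !divn2.
Qed.

Lemma bits_bij n : bijective (fun i : 'I_(2 ^ n) => bits n i).
Proof.
apply: inj_card_bij; last by rewrite card_tuple card_bool card_ord.
move=> i k eq_ik; apply/val_inj/(@eq_binary_digits n) => [||j ltjn].
- exact: ltn_ord i.
- exact: ltn_ord k.
- by have := congr1 (fun t => tnth t (Ordinal ltjn)) eq_ik; rewrite !tnth_mktuple.
Qed.

Lemma bits_onto n (x : n.-tuple bool) : exists2 i, i < 2 ^ n & bits n i = x.
Proof. by have [b _ bK] := bits_bij n; exists (b x); last exact: bK. Qed.

Lemma size_truth_table n (f : bfun n) : size (truth_table f) = 2 ^ n.
Proof. by rewrite size_map size_iota. Qed.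

Lemma nth_truth_table n (f : bfun n) i :
  i < 2 ^ n -> nth false (truth_table f) i = f (bits n i).
Proof. by move=> ltin; rewrite (nth_map 0) ?size_iota// nth_iota. Qed.

Lemma truth_table_inj n : injective (@truth_table n).
Proof.
move=> f g eq_fg; apply/ffunP=> x; have [i ltin <-] := bits_onto x.
by rewrite -!nth_truth_table// eq_fg.
Qed.

(** As tuples of fixed length, truth tables turn a uniform function into a uniform string of [2 ^ n]
    bits, which is what the counting below works with. *)
Canonical truth_table_tuple n (f : bfun n) : (2 ^ n).-tuple bool :=
  Tuple (introT eqP (size_truth_table f)).

Lemma truth_table_bij n : bijective (@truth_table_tuple n).
Proof.
apply: inj_card_bij => [f g /(congr1 val)/truth_table_inj//|].
by rewrite card_ffun !card_tuple card_bool.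
Qed.

Lemma truth_table_onto n (w : seq bool) : size w = 2 ^ n ->
  exists f : bfun n, truth_table f = w.
Proof.
move=> /eqP sz; have [h _ hK] := truth_table_bij n.
by exists (h (Tuple sz)); have := congr1 val (hK (Tuple sz)).
Qed.

(** The length of a truth table determines the number of variables, and the table then determines
    the function. *)
Lemma property_languageP (Rn : property) n (f : bfun n) :
  property_language Rn (truth_table f) <-> f \in Rn n.
Proof.
split=> [[k [g [gR eq_fg]]]|fR]; last by exists n, f.
have eq_nk: n = k.
  by apply: (@expnI 2) => //; rewrite -(size_truth_table f) eq_fg size_truth_table.
by move: g gR eq_fg; rewrite -eq_nk => g gR /truth_table_inj->.
Qed.

(** The low coordinates are free and the others are fixed to the digits of [z]. As [bits] puts the
    least significant bit first, the points of such a subcube are consecutive in the truth table. *)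
Definition subcube_input m n z (x : m.-tuple bool) : n.-tuple bool :=
  [tuple if insub (val j) is Some i then tnth x i else odd (z %/ 2 ^ j) | j < n].

Definition subcube m n z (f : bfun n) : bfun m :=
  [ffun x => f (subcube_input n z x)].

(** Since [2 ^ m] divides [z], adding [y < 2 ^ m] writes the digits of [y] into the [m] low places
    and leaves the others alone. *)
Lemma truth_table_subcube m n z (f : bfun n) : 2 ^ m %| z -> z + 2 ^ m <= 2 ^ n ->
  truth_table (subcube m z f) = take (2 ^ m) (drop z (truth_table f)).
Proof.
move=> dvd_z le_zn; apply: (@eq_from_nth _ false) => [|y].
  by rewrite size_takel ?size_drop !size_truth_table//; lia.
rewrite size_truth_table => ltym; rewrite nth_take// nth_drop.
rewrite !nth_truth_table//; last by lia.
rewrite ffunE; congr (f _); apply: eq_from_tnth => j; rewrite !tnth_mktuple.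
case: insubP => [i ltjm /= eq_ij|]; last first.
  rewrite -leqNgt => lemj; rewrite -(subnKC lemj) expnD !divnMA divnDl//.
  by rewrite (divn_small ltym) addn0.
rewrite tnth_mktuple eq_ij; move: dvd_z => /dvdnP[v ->]; have ltim := ltn_ord i.
(* For [j < m], this factor 2 makes the contribution of [z] to the quotient by [2 ^ j] even. *)
have -> : 2 ^ m = 2 ^ (m - j).-1 * 2 * 2 ^ j by rewrite -expnSr -expnD; congr (2 ^ _); lia.
rewrite mulnA divnMDl ?expn_gt0// oddD mulnA oddM andbF; congr odd.
Qed.

(** * Restriction of circuits to subcubes *)

Section Subcube.
Variables (m n z : nat).

(** Fixed inputs become constants while gates and wires stay, so size, depth, fan-in and the formula
    property are preserved. *)
Definition subcube_node (nd : node n) : node m :=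
  match nd with
  | Input j => if insub (val j) is Some i then Input i
               else Constant (odd (z %/ 2 ^ j))
  | Constant b => Constant b
  | Gate g args => Gate g args
  end.

Lemma fanin_subcube nd : fanin (subcube_node nd) = fanin nd.
Proof. by case: nd => //= j; case: insub. Qed.

Lemma node_eval_subcube x vals nd :
  node_eval x vals (subcube_node nd) = node_eval (subcube_input n z x) vals nd.
Proof. by case: nd => //= j; rewrite tnth_mktuple; case: insub. Qed.

Lemma node_depth_subcube ds nd : node_depth ds (subcube_node nd) = node_depth ds nd.
Proof. by case: nd => //= j; case: insub. Qed.

Lemma node_allowed_subcube K c c' nd : c <= c' ->
  node_allowed K c nd -> node_allowed K c' (subcube_node nd).
Proof.
move=> lecc; case: nd => [j|//|g args] /=; first by case: insub.
case: g => // d; case: K => //= /andP[-> /leq_trans]; exact.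
Qed.

Lemma circuit_eval_subcube C x :
  circuit_eval (map subcube_node C) x = circuit_eval C (subcube_input n z x).
Proof.
rewrite /circuit_eval; congr last; elim: C [::] => //= nd C IHC vals.
by rewrite node_eval_subcube IHC.
Qed.

Lemma depth_subcube C : depth (map subcube_node C) = depth C.
Proof.
rewrite /depth; congr last; elim: C [::] => //= nd C IHC ds.
by rewrite node_depth_subcube IHC.
Qed.

Lemma map_fanin_subcube C :
  [seq fanin nd | nd <- map subcube_node C] = [seq fanin nd | nd <- C].
Proof. by rewrite -map_comp; apply: eq_map => nd /=; exact: fanin_subcube. Qed.

Lemma well_formed_subcube C : well_formed C -> well_formed (map subcube_node C).
Proof.
rewrite /well_formed size_map => /andP[-> /forallP wfC] /=.
apply/forallP => i; have ltiC := ltn_ord i.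
by rewrite (nth_map (Constant false))// fanin_subcube; have := wfC (Ordinal ltiC).
Qed.

(** The second hypothesis is for NC1, whose depth bound refers to the number of variables and so
    becomes stricter when this drops from [n] to [m]. *)
Lemma computable_in_subcube K c c' s s' (f : bfun n) :
  c <= c' -> c * up_log 2 n <= c' * up_log 2 m -> s <= s' ->
  computable_in K c s f -> computable_in K c' s' (subcube m z f).
Proof.
move=> lecc leccl less [C [wfC allC shC szC evC]].
exists (map subcube_node C); split.
- exact: well_formed_subcube.
- rewrite all_map; apply: sub_all allC => nd; exact: node_allowed_subcube.
- case: K shC {allC} => //=; rewrite /is_formula ?map_fanin_subcube ?depth_subcube//.
  all: try by move=> *; apply: leq_trans lecc.
  by move=> /leq_trans; exact.
- have -> : size_wires (map subcube_node C) = size_wires C.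
    rewrite /size_wires -map_comp; congr sumn.
    by apply: eq_map => nd /=; rewrite fanin_subcube.
  exact: leq_trans less.
- by move=> x; rewrite circuit_eval_subcube evC ffunE.
Qed.

End Subcube.

(** * Running programs *)

Section Runs.
Variables input oracle : seq bool.

Lemma iter_step_halted cf t : halted cf -> iter t (step input oracle) cf = cf.
Proof. by case: cf => [[|//] s] _; elim: t => //= t ->. Qed.

Lemma run_halted M r t u : t <= u -> halted (run M input oracle r t) ->
  run M input oracle r u = run M input oracle r t.
Proof.
by move=> letu; rewrite /run -(subnK letu) iterD => /iter_step_halted ->.
Qed.

(** A total-correctness triple with a time bound. Quantifying over the rest [k] of the stack is what
    makes these triples compose. *)
Definition runs_to (p : program) (B : nat) (Q : state -> Prop) (s : state) :=
  exists t s', [/\ t <= B, Q s' &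
    forall k, iter t (step input oracle) (p :: k, s) = (k, s')].

Lemma runs_to_le p B B' (Q Q' : state -> Prop) s :
  B <= B' -> (forall s', Q s' -> Q' s') ->
  runs_to p B Q s -> runs_to p B' Q' s.
Proof.
move=> leB subQ [t [s' [letB Qs' runp]]]; exists t, s'.
by split; [exact: leq_trans leB | exact: subQ |].
Qed.

Lemma runs_to_seq B C D p q Q s : B + C < D ->
  runs_to p B (runs_to q C Q) s -> runs_to (Seq p q) D Q s.
Proof.
move=> ltD [t [s1 [letB [u [s2 [leuC Qs2 runq]]] runp]]].
exists (u + t).+1, s2; split=> [|//|k]; first by lia.
by rewrite iterSr /= iterD runp runq.
Qed.

Lemma runs_to_if B D x p q Q s : B < D ->
  runs_to (if regs s x != 0 then p else q) B Q s -> runs_to (If x p q) D Q s.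
Proof.
move=> ltD [t [s' [letB Qs' runp]]]; exists t.+1, s'; split=> [|//|k]; first by lia.
by rewrite iterSr /= runp.
Qed.

Lemma runs_to_while (I : nat -> state -> Prop) B j D x p s : j * B.+1 < D ->
  (forall i s', I i.+1 s' -> regs s' x != 0 /\ runs_to p B (I i) s') ->
  (forall s', I 0 s' -> regs s' x = 0) ->
  I j s -> runs_to (While x p) D (I 0) s.
Proof.
move=> ltD Istep Iend Is.
apply: (@runs_to_le _ (j * B.+1).+1 _ (I 0)) => // {D ltD}.
elim: j s Is => [|j IHj] s Is.
  by exists 1, s; split=> // k; rewrite /= Iend.
have [x_neq0 [t [s1 [letB /IHj[u [s2 [leuj Is2 runw]]] runp]]]] := Istep _ _ Is.
exists (u + t).+1, s2; split=> [|//|k]; first by lia.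
by rewrite iterSr /= x_neq0 iterD runp runw.
Qed.

(* Meaningless for programs with loops or coin tosses. *)
Fixpoint effect (p : program) (s : state) : state :=
  match p with
  | Assign x v => set_reg s x v
  | Add x y z => set_reg s x (regs s y + regs s z)
  | Defs.Sub x y z => set_reg s x (regs s y - regs s z)
  | HeapGet x y => set_reg s x (heap s (regs s y))
  | HeapSet x y =>
      State (regs s) [eta heap s with regs s x |-> regs s y] (coins s)
  | Read x y => set_reg s x (cell input (regs s y))
  | Query x y => set_reg s x (cell oracle (regs s y))
  | Seq p q => effect q (effect p s)
  | If x p q => if regs s x != 0 then effect p s else effect q s
  | _ => s
  end.

Fixpoint loop_free (p : program) : bool :=
  match p with
  | Toss _ | While _ _ => false
  | Seq p q | If _ p q => loop_free p && loop_free q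
  | _ => true
  end.

Fixpoint program_size (p : program) : nat :=
  match p with
  | Seq p q | If _ p q => (program_size p + program_size q).+1
  | While _ p => (program_size p).+1
  | _ => 1
  end.

(** Straight-line code is verified by computing its effect; its size bounds the time, as no part of
    it runs twice. *)
Lemma runs_to_effect p B Q s : loop_free p -> program_size p <= B ->
  Q (effect p s) -> runs_to p B Q s.
Proof.
move=> lfp szp Qs; apply: (@runs_to_le _ (program_size p) _ (eq (effect p s))) => //.
  by move=> _ <-.
elim: p s lfp {B szp Q Qs} => //=.
all: try by move=> *; exists 1; eexists; split.
- move=> p IHp q IHq s /andP[/IHp{}IHp /IHq{}IHq].
  apply: (runs_to_seq (ltnSn _)); apply: runs_to_le (IHp s) => // _ <-.
  exact: IHq.
- move=> x p IHp q IHq s /andP[/IHp{}IHp /IHq{}IHq].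
  apply: (@runs_to_if (program_size p + program_size q)) => //.
  case: (regs s x != 0).
    by apply: runs_to_le (IHp s) => //; lia.
  by apply: runs_to_le (IHq s) => //; lia.
Qed.

Lemma runs_to_effect_seq C D p q Q s : loop_free p -> program_size p + C < D ->
  runs_to q C Q (effect p s) -> runs_to (Seq p q) D Q s.
Proof. by move=> lfp ltD runq; apply: runs_to_seq ltD _; exact: runs_to_effect. Qed.

Lemma runs_to_run p B Q r : 
  runs_to p B Q (State (fun=> 0) (fun=> 0) r) ->
  halted (run p input oracle r B) /\ Q (run p input oracle r B).2.
Proof.
move=> [t [s' [letB Qs' runp]]].
have runt : run p input oracle r t = ([::], s') by rewrite /run runp.
by rewrite (run_halted letB) ?runt.
Qed.

End Runs.

(** * Simulation on a segment of a truth table *)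

(* Register [x] of a simulated machine is register [guest x] of the host, which
   keeps registers 0 to 19 for itself.  It is a notation because comparisons
   with literals then simplify. *)
Notation guest x := (x.+4.+4.+4.+4.+4) (only parsing).

Fixpoint registers_below (b : nat) (p : program) : bool :=
  match p with
  | Skip => true
  | Assign x _ | Toss x => x < b
  | Add x y z | Defs.Sub x y z => [&& x < b, y < b & z < b]
  | HeapGet x y | HeapSet x y | Read x y | Query x y => (x < b) && (y < b)
  | Seq p q => registers_below b p && registers_below b q
  | If x p q => [&& x < b, registers_below b p & registers_below b q]
  | While x p => (x < b) && registers_below b p
  end.

Lemma registers_below_leq b b' p :
  b <= b' -> registers_below b p -> registers_below b' p.
Proof.
move=> lebb; elim: p => //=; lia.
Qed.

Lemma ex_registers_below p : exists b, 0 < b /\ registers_below b p.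
Proof.
elim: p => /=.
all: try by move=> x y; exists (x + y).+1; lia.
- by exists 1.
- by move=> x y z; exists (x + y + z).+1; lia.
- by move=> x y z; exists (x + y + z).+1; lia.
- by move=> x; exists x.+1; lia.
- move=> p [b [b_gt0 pb]] q [c [_ qc]]; exists (b + c); split; first by lia.
  by rewrite (registers_below_leq _ pb) ?(registers_below_leq _ qc)//; lia.
- move=> x p [b [b_gt0 pb]] q [c [_ qc]]; exists (x + b + c); split; first by lia.
  by rewrite (registers_below_leq _ pb) ?(registers_below_leq _ qc)//; lia.
- move=> x p [b [b_gt0 pb]]; exists (x + b); split; first by lia.
  by rewrite (registers_below_leq _ pb)//; lia.
Qed.

Section Compile.
(* The host finds a string [w] in its oracle if [hq] holds, in its input
   otherwise.  If [gq] holds, the guest has input [1^m] and a segment of [w] as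
   its oracle; otherwise its input is this segment, and its oracle is empty. *)
Variables hq gq : bool.

Definition access x y := if hq then Query x y else Read x y.

Fixpoint double_reg (k x : nat) : program :=
  if k is k'.+1 then Seq (Add x x x) (double_reg k' x) else Skip.

Definition copy_reg x y := Seq (Assign x 0) (Add x x y).

(* Host registers: 1 holds the constant 1, 7 holds [m], 8 holds [2 ^ m], 10 the
   number [i] of the simulated run, 11 the beginning of its segment of [w], and
   12 the position of its next coin toss; 14 and 15 are temporary. *)
Definition read_segment x y :=
  Seq (Defs.Sub 14 8 y) (If 14 (Seq (Add 15 11 y) (access x 15)) (Assign x 2)).

Definition read_unary x y :=
  Seq (Defs.Sub 14 7 y) (If 14 (Assign x 1) (Assign x 2)).

(* Run [i] uses the heap cells congruent to [i] modulo [m], because it must not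
   find what the previous runs left behind. *)
Definition heap_address y :=
  Seq (copy_reg 15 10) (Seq (copy_reg 14 7)
    (While 14 (Seq (Add 15 15 y) (Defs.Sub 14 14 1)))).

(** A toss becomes a read of the next bit of [w] after the segment, so the compiled program is
    deterministic. A query to the empty oracle yields the end marker 2. *)
Fixpoint compile (p : program) : program :=
  match p with
  | Skip => Skip
  | Assign x v => Assign (guest x) v
  | Add x y z => Add (guest x) (guest y) (guest z)
  | Defs.Sub x y z => Defs.Sub (guest x) (guest y) (guest z)
  | HeapGet x y => Seq (heap_address (guest y)) (HeapGet (guest x) 15)
  | HeapSet x y => Seq (heap_address (guest x)) (HeapSet 15 (guest y))
  | Read x y => (if gq then read_unary else read_segment) (guest x) (guest y)
  | Query x y => if gq then read_segment (guest x) (guest y)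
                 else Assign (guest x) 2
  | Toss x => Seq (access (guest x) 12) (Add 12 12 1)
  | Seq p q => Seq (compile p) (compile q)
  | If x p q => If (guest x) (compile p) (compile q)
  | While x p => While (guest x) (compile p)
  end.

Lemma toss_free_compile p : toss_free (compile p).
Proof.
elim: p => //=; rewrite /access /read_segment /read_unary /access.
- by case: gq; case: hq.
- by case: gq; case: hq.
- by case: hq.
- by move=> p -> q ->.
- by move=> _ p -> q ->.
Qed.

(** * Correctness of the simulation *)

Section Simulation.
Variables (input oracle w : seq bool).
Hypothesis wE : forall y, cell (if hq then oracle else input) y = cell w y.
Variables (b m i base T : nat).
Hypotheses (ltim : i < m) (le_seg : base + 2 ^ m + T <= size w).

Let seg := take (2 ^ m) (drop base w).
Let ginput := if gq then nseq m true else seg.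
Let goracle := if gq then seg else [::].
Let gcoins := take T (drop (base + 2 ^ m) w).

Variable s0 : state.
Hypotheses (s0_1 : regs s0 1 = 1) (s0_7 : regs s0 7 = m).
Hypotheses (s0_8 : regs s0 8 = 2 ^ m) (s0_10 : regs s0 10 = i).
Hypotheses (s0_11 : regs s0 11 = base) (s0_12 : regs s0 12 = base + 2 ^ m).

(** [u] counts the coins tossed so far. [sim_fresh] keeps the heap cells of later runs empty; those
    of earlier runs may hold anything. *)
Record simulates (u : nat) (s s' : state) : Prop := Simulates {
  sim_regs : forall x, x < b -> regs s' (guest x) = regs s x;
  sim_host : forall x, x < 20 -> x \notin [:: 12; 14; 15] -> regs s' x = regs s0 x;
  sim_pos : regs s' 12 = base + 2 ^ m + u;
  sim_heap : forall y, heap s' (i + m * y) = heap s y;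
  sim_fresh : forall j y, i < j < m -> heap s' (j + m * y) = 0;
  sim_coins : coins s = drop u gcoins }.

Lemma effect_access x y s :
  effect input oracle (access x y) s = set_reg s x (cell w (regs s y)).
Proof. by rewrite /access -wE; case: hq. Qed.

Lemma program_size_access x y : program_size (access x y) = 1.
Proof. by rewrite /access; case: hq. Qed.

Lemma loop_free_access x y : loop_free (access x y).
Proof. by rewrite /access; case: hq. Qed.

Lemma size_seg : size seg = 2 ^ m.
Proof. by rewrite size_takel// size_drop; lia. Qed.

Lemma cell_seg y : cell seg y = if y < 2 ^ m then cell w (base + y) else 2.
Proof.
rewrite /cell size_seg; case: ltnP => // lty.
by rewrite nth_take// nth_drop ifT//; lia.
Qed.

(** A frame rule for all instructions that set one guest register: besides it, only the temporary
    registers 14 and 15 may be spoiled. *)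
Lemma simulates_set u s s' s1' x v : simulates u s s' ->
  heap s1' = heap s' -> regs s1' (guest x) = v ->
  (forall y, y != x -> regs s1' (guest y) = regs s' (guest y)) ->
  (forall z, z < 20 -> z \notin [:: 14; 15] -> regs s1' z = regs s' z) ->
  simulates u (set_reg s x v) s1'.
Proof.
move=> [sr sh sp shp sf sc] heq req gueq hoeq; split=> //=.
- by move=> y ltyb; case: eqVneq => [->//|neq]; rewrite gueq// sr.
- by move=> z ltz nz; rewrite hoeq ?sh//; move: nz; rewrite !inE; lia.
- by rewrite hoeq.
- by move=> y; rewrite heq.
- by move=> j y ltj; rewrite heq sf.
Qed.

Lemma runs_to_read_segment u s s' x y : simulates u s s' -> y < b ->
  runs_to input oracle (read_segment (guest x) (guest y)) 20
    (simulates u (set_reg s x (cell seg (regs s y)))) s'.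
Proof.
move=> sim lty; apply: runs_to_effect.
- by rewrite /= loop_free_access.
- by rewrite /= program_size_access.
have h8 := sim_host sim (isT : 8 < 20) isT.
have h11 := sim_host sim (isT : 11 < 20) isT.
rewrite /= effect_access /= (sim_regs sim lty) h8 s0_8 subn_eq0 -ltnNge cell_seg h11 s0_11.
case: ltnP => _; apply: (simulates_set sim) => //=; rewrite ?eqxx//.
all: rewrite ?addnA.
all: try by move=> z /negbTE; rewrite !eqSS => ->.
all: by move=> z ltz; rewrite !inE => /norP[/negbTE n14 /negbTE n15];
  rewrite ?n14 ?n15 ltn_eqF//; lia.
Qed.

(** The machine cannot multiply, so the product by [m] is formed by [m] additions; hence a heap
    access costs O(m) steps. *)
Lemma runs_to_heap_address y s : regs s 1 = 1 -> regs s 7 = m -> regs s 10 = i ->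
  runs_to input oracle (heap_address (guest y)) (4 * m + 20)
    (fun s1 => [/\ heap s1 = heap s,
      regs s1 15 = i + m * regs s (guest y),
      forall z, regs s1 (guest z) = regs s (guest z) &
      forall z, z \notin [:: 14; 15] -> regs s1 z = regs s z]) s.
Proof.
move=> s1E s7 s10.
apply: (@runs_to_effect_seq _ _ (4 * m + 10)); [by []|by rewrite /=; lia|].
apply: (@runs_to_effect_seq _ _ (4 * m + 5)); [by []|by rewrite /=; lia|].
set s1 := effect _ _ _ _.
pose I j s' := [/\ j <= m, heap s' = heap s, regs s' 14 = j,
  regs s' 15 + j * regs s (guest y) = i + m * regs s (guest y) &
  forall z, z \notin [:: 14; 15] -> regs s' z = regs s z].
apply: (@runs_to_le _ _ _ (4 * m + 1) _ (I 0)); first by lia.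
  move=> s' [_ hs' _ s15 sz]; split=> // [|z]; first by rewrite -s15 mul0n addn0.
  exact: sz.
apply: (@runs_to_while _ _ I 3 m); first by lia.
- move=> j s' [ltjm hs' s14 s15 sz]; split; first by rewrite s14.
  apply: runs_to_effect => //=; split=> /=.
  + exact: ltnW.
  + by [].
  + by rewrite s14 sz// s1E subn1.
  + by rewrite (sz (guest y)) // -s15 mulSn; lia.
  + move=> z nz; move: (nz); rewrite !inE => /norP[/negbTE-> /negbTE->]; exact: sz.
- by move=> s' [].
- split; rewrite // /s1 /= ?s7 ?s10; try by lia.
  by move=> z; rewrite !inE => /norP[/negbTE-> /negbTE->].
Qed.

(** Reduction modulo [m] recovers the number of the run, so different runs use disjoint heap
    cells. *)
Lemma eq_stride j k y z : j < m -> k < m ->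
  (j + m * y == k + m * z) = (j == k) && (y == z).
Proof.
move=> ltj ltk; apply/eqP/andP => [eq_jk|[/eqP-> /eqP->]//].
have eqm : j = k.
  move: (congr1 (modn^~ m) eq_jk).
  by rewrite ![_ + m * _]addnC ![m * _]mulnC !modnMDl !modn_small.
split; apply/eqP=> //; move/eqP: eq_jk.
by rewrite eqm eqn_add2l eqn_pmul2l ?(leq_ltn_trans _ ltk)// => /eqP.
Qed.

Let primitive (p : program) :=
  match p with Seq _ _ | If _ _ _ | While _ _ => false | _ => true end.

Lemma simulates_primitive u p k s s' :
  primitive p -> simulates u s s' -> u < T -> registers_below b p ->
  runs_to input oracle (compile p) (4 * m + 30)
    (fun s1' => exists2 u1, u1 <= u.+1 &
       simulates u1 (step ginput goracle (p :: k, s)).2 s1') s'.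
Proof.
move=> primp sim ltuT pb.
have hosts := sim_host sim.
have [s1 s7 s10] : [/\ regs s' 1 = 1, regs s' 7 = m & regs s' 10 = i].
  by rewrite !hosts.
(* This serves [Read] when the segment is the guest's input, and [Query] when it is the guest's
   oracle. *)
have segment x y q : y < b -> q = read_segment (guest x) (guest y) ->
    runs_to input oracle q (4 * m + 30) (fun s1' => exists2 u1, u1 <= u.+1 &
      simulates u1 (set_reg s x (cell seg (regs s y))) s1') s'.
  move=> ltyb ->; apply: runs_to_le (runs_to_read_segment x sim ltyb); first by lia.
  by move=> s1' sim1; exists u.
have gregs := sim_regs sim.
case: p primp pb => //.
- by move=> _ _; apply: runs_to_effect; rewrite //=; [lia | exists u].
- move=> x v _ /= ltxb; apply: runs_to_effect; rewrite //=; first by lia.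
  exists u => //; apply: (simulates_set sim) => //=; rewrite ?eqxx// => z.
    by rewrite !eqSS => /negbTE->.
  by move=> ltz _; rewrite ltn_eqF//; lia.
- move=> x y z _ /= /and3P[ltxb ltyb ltzb]; apply: runs_to_effect; rewrite //=; first by lia.
  exists u => //; apply: (simulates_set sim) => //=; rewrite ?eqxx ?gregs// => v.
    by rewrite !eqSS => /negbTE->.
  by move=> ltv _; rewrite ltn_eqF//; lia.
- move=> x y z _ /= /and3P[ltxb ltyb ltzb]; apply: runs_to_effect; rewrite //=; first by lia.
  exists u => //; apply: (simulates_set sim) => //=; rewrite ?eqxx ?gregs// => v.
    by rewrite !eqSS => /negbTE->.
  by move=> ltv _; rewrite ltn_eqF//; lia.
- move=> x y _ /= /andP[ltxb ltyb].
  apply: (@runs_to_seq _ _ (4 * m + 20) 1); first by lia.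
  apply: runs_to_le (runs_to_heap_address y s1 s7 s10) => // s2 [hs2 s2_15 s2g s2h].
  apply: runs_to_effect => //; exists u => //; apply: (simulates_set sim) => //=.
  + by rewrite eqxx s2_15 hs2 gregs// (sim_heap sim).
  + by move=> z; rewrite !eqSS => /negbTE->; exact: s2g.
  + by move=> z ltz nz; rewrite ltn_eqF ?s2h//; lia.
- move=> x y _ /= /andP[ltxb ltyb].
  apply: (@runs_to_seq _ _ (4 * m + 20) 1); first by lia.
  apply: runs_to_le (runs_to_heap_address x s1 s7 s10) => // s2 [hs2 s2_15 s2g s2h].
  apply: runs_to_effect => //; exists u => //; split=> /=.
  + by move=> z ltz; rewrite s2g gregs.
  + move=> z ltz nz; rewrite s2h ?hosts//; move: nz; rewrite !inE; lia.
  + by rewrite s2h// (sim_pos sim).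
  + move=> z; rewrite s2_15 hs2 s2g !gregs// eq_stride// eqxx /=.
    by case: eqP => // _; exact: (sim_heap sim z).
  + move=> j z /andP[ltij ltjm]; rewrite s2_15 eq_stride// gtn_eqF//= hs2.
    by rewrite (sim_fresh sim)// ltij.
  + exact: (sim_coins sim).
- move=> x y _ /= /andP[ltxb ltyb]; rewrite /ginput; case: gq; last exact: segment.
  apply: runs_to_effect; rewrite //=; first by lia.
  rewrite s7 gregs// subn_eq0 -ltnNge /cell size_nseq nth_nseq.
  exists u => //; case: ltnP => _; apply: (simulates_set sim) => //=; rewrite ?eqxx// => z;
    first [by rewrite !eqSS => /negbTE-> | move=> ltz];
    rewrite !inE => /norP[/negbTE n14 /negbTE n15];
    by rewrite ltn_eqF ?n14//; lia.
- move=> x y _ /= /andP[ltxb ltyb]; rewrite /goracle; case: gq; first exact: segment.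
  apply: runs_to_effect; rewrite //=; first by lia.
  exists u => //; apply: (simulates_set sim) => //=; rewrite ?eqxx// => v.
    by rewrite !eqSS => /negbTE->.
  by move=> ltv _; rewrite ltn_eqF//; lia.
- move=> x _ /= ltxb; apply: runs_to_effect.
  + by rewrite /= loop_free_access.
  + by rewrite /= program_size_access; lia.
  (* As [u < T], the position lies inside [w], so a bit is read and not the end marker. *)
  have tossE : cell w (base + 2 ^ m + u) = head false (coins s).
    rewrite /cell ifT; last by lia.
    rewrite (sim_coins sim) -nth0 nth_drop addn0 nth_take//.
    by rewrite nth_drop.
  exists u.+1 => //=; rewrite effect_access (sim_pos sim) tossE; split=> //=.
  + by move=> z ltzb; rewrite !eqSS; case: eqP => // _; exact: gregs.
  + move=> z ltz; rewrite !inE => /norP[/negbTE n12 nz].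
    rewrite n12 ltn_eqF; last by lia.
    by apply: hosts => //; rewrite !inE n12.
  + by rewrite (sim_pos sim) s1 addn1 addnS.
  + exact: (sim_heap sim).
  + by move=> j z; apply: (sim_fresh sim).
  + by rewrite (sim_coins sim) -drop1 drop_drop add1n.
Qed.

(** Control constructs compile to themselves, so the host stack is the compiled guest stack on top
    of [l], the remaining work of the host. *)
Lemma simulates_step u p k s s' :
  simulates u s s' -> u < T -> registers_below b p ->
  let: (k1, s1) := step ginput goracle (p :: k, s) in
  exists t s1' u1, [/\ t <= 4 * m + 30, u1 <= u.+1, simulates u1 s1 s1' &
    forall l, iter t (step input oracle) (compile p :: map compile k ++ l, s') =
              (map compile k1 ++ l, s1')].
Proof.
move=> sim ltuT pb; have gregs := sim_regs sim.
have [primp|] := boolP (primitive p).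
  have [t [s1' [ltt [u1 leu1 sim1] runp]]] :=
    simulates_primitive k primp sim ltuT pb.
  have -> : step ginput goracle (p :: k, s) =
            (k, (step ginput goracle (p :: k, s)).2) by case: (p) primp.
  by exists t, s1', u1; split.
case: p pb => //= [p q|x p q|x p] pb _; exists 1, s', u; split=> //=; try by lia.
- by case/andP: pb => ltxb _ l; rewrite gregs//; case: (regs s x != 0).
- by case/andP: pb => ltxb _ l; rewrite gregs//; case: (regs s x != 0).
Qed.

(** A step tosses at most one coin, so [u + t <= T] keeps the coin position within the [T] bits
    reserved for it. *)
Lemma simulates_run t u k s s' : simulates u s s' -> u + t <= T ->
  all (registers_below b) k ->
  halted (iter t (step ginput goracle) (k, s)) ->
  exists t' s1' u1, [/\ t' <= (4 * m + 30) * t,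
    simulates u1 (iter t (step ginput goracle) (k, s)).2 s1' &
    forall l, iter t' (step input oracle) (map compile k ++ l, s') = (l, s1')].
Proof.
elim: t u k s s' => [|t IHt] u k s s' sim letT kb.
  rewrite /= /halted /= => /nilP->.
  by exists 0, s', u; split.
rewrite iterSr; case: k kb => [_ _|p k /= /andP[pb kb]].
  exists 0, s', u; split=> //=.
  by rewrite iter_step_halted.
have ltuT : u < T by lia.
have := simulates_step k sim ltuT pb.
have : all (registers_below b) (step ginput goracle (p :: k, s)).1.
  case: (p) pb => //= [p1 p2 /andP[-> ->]//|x p1 p2|x p1].
    by case/and3P=> _ p1b p2b; case: ifP => _; rewrite /= ?p1b ?p2b.
  by case/andP=> ltxb p1b; case: ifP => _ //=; rewrite ltxb p1b.
rewrite -/(step ginput goracle (p :: k, s)).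
case: (step _ _ _) => k1 s1 /= k1b [t1 [s1' [u1 [let1 leu1 sim1 run1]]]] hlt.
have [|t2 [s2' [u2 [let2 sim2 run2]]]] := IHt _ _ _ _ sim1 _ k1b hlt; first by lia.
exists (t2 + t1), s2', u2; split=> // [|l]; first by lia.
by rewrite iterD run1 run2.
Qed.

(** Cleared registers and empty cells look to the guest like its initial state. The cells of later
    runs stay empty, so the next block can start in the same way. *)
Lemma runs_to_compile M : registers_below b M ->
  (forall x, x < b -> regs s0 (guest x) = 0) ->
  (forall j y, i <= j < m -> heap s0 (j + m * y) = 0) ->
  halted (run M ginput goracle gcoins T) ->
  runs_to input oracle (compile M) ((4 * m + 30) * T) (fun s =>
    [/\ forall x, x < b -> regs s (guest x) = regs (run M ginput goracle gcoins T).2 x,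
        forall x, x < 20 -> x \notin [:: 12; 14; 15] -> regs s x = regs s0 x &
        forall j y, i < j < m -> heap s (j + m * y) = 0]) s0.
Proof.
move=> Mb gregs gheap hlt.
have sim0 : simulates 0 (State (fun=> 0) (fun=> 0) gcoins) s0.
  split=> //=; first by rewrite addn0.
  - by move=> y; rewrite gheap// leqnn.
  - by move=> j y /andP[ltij ltjm]; rewrite gheap// (ltnW ltij).
  - by rewrite drop0.
have [|t' [s1 [u1 [let' sim1 runM]]]] :=
  simulates_run sim0 (leqnn T) (k := [:: M]) _ hlt; first by rewrite /= Mb.
exists t', s1; split; [exact: let' | split | exact: runM].
- by move=> x ltxb; rewrite (sim_regs sim1).
- exact: sim_host sim1.
- exact: sim_fresh sim1.
Qed.

End Simulation.
End Compile.

(** * The deterministic machine *)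

Lemma loop_free_double_reg k x : loop_free (double_reg k x).
Proof. by elim: k. Qed.

Lemma toss_free_double_reg k x : toss_free (double_reg k x).
Proof. by elim: k. Qed.

Lemma program_size_double_reg k x : program_size (double_reg k x) = (2 * k).+1.
Proof. by elim: k => //= k ->; lia. Qed.

Lemma regs_double_reg input oracle k x s z :
  regs (effect input oracle (double_reg k x) s) z =
  if z == x then 2 ^ k * regs s x else regs s z.
Proof.
elim: k s => [|k IHk] s /=; first by rewrite mul1n; case: eqP => // ->.
by rewrite IHk /= eqxx; case: eqP => // _; rewrite expnS; lia.
Qed.

Lemma heap_double_reg input oracle k x s :
  heap (effect input oracle (double_reg k x) s) = heap s.
Proof. by elim: k s => //= k IHk s; rewrite IHk. Qed.

(** A program mentions only finitely many registers, so these can be cleared between runs, whereas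
    the heap is shared out among them. *)
Fixpoint reset (b : nat) : program :=
  if b is b'.+1 then Seq (Assign (guest b') 0) (reset b') else Skip.

Lemma loop_free_reset b : loop_free (reset b).
Proof. by elim: b. Qed.

Lemma toss_free_reset b : toss_free (reset b).
Proof. by elim: b. Qed.

Lemma program_size_reset b : program_size (reset b) = (2 * b).+1.
Proof. by elim: b => //= b ->; lia. Qed.

Lemma regs_reset_guest input oracle b s x :
  x < b -> regs (effect input oracle (reset b) s) (guest x) = 0.
Proof.
have zeroed c s' y : regs s' (guest y) = 0 ->
    regs (effect input oracle (reset c) s') (guest y) = 0.
  by elim: c s' => //= c IHc s' s'y; rewrite IHc//= s'y; case: ifP.
elim: b s => //= b IHb s; rewrite ltnS leq_eqVlt => /predU1P[->|/IHb//].
by rewrite zeroed//= eqxx.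
Qed.

Lemma regs_reset_host input oracle b s x :
  x < 20 -> regs (effect input oracle (reset b) s) x = regs s x.
Proof.
by move=> ltx; elim: b s => //= b IHb s; rewrite IHb /= ltn_eqF//; lia.
Qed.

Lemma heap_reset input oracle b s : heap (effect input oracle (reset b) s) = heap s.
Proof. by elim: b s => //= b IHb s; rewrite IHb. Qed.

(* This is [n ^ (1 / a)] up to a factor 2, but can be computed without
   multiplications. *)
Definition block_arity (a n : nat) : nat := 2 ^ trunc_log (2 ^ a) n.

Section Main.
Variables (hq gq : bool) (M : program) (b a d m0 : nat) (T : nat -> nat).

(* Registers 2 and 3 hold [2 ^ n] and [n], register 6 a power of [2 ^ a],
   register 9 the block size, register 13 the number of blocks left, and
   register 0 whether a block has been accepted; 4 and 5 are temporary. *)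
Definition probe := Seq (access hq 4 2) (Defs.Sub 4 5 4).

(** Powers of two are tried until one is no longer an index into the string, which gives [n]. The
    length is [2 ^ n] if and only if position [2 ^ n - 1] still is one. *)
Definition find_length :=
  Seq (Seq (Assign 1 1) (Seq (Assign 2 1) (Seq (Assign 5 2) probe)))
 (Seq (While 4 (Seq (Add 2 2 2) (Seq (Add 3 3 1) probe)))
      (Seq (Defs.Sub 4 2 1) (Seq (access hq 4 4) (Defs.Sub 4 5 4)))).

Definition find_arity :=
  Seq (Seq (Assign 6 1) (Seq (double_reg a 6) (Seq (Assign 7 1)
        (Seq (Add 5 3 1) (Defs.Sub 4 5 6)))))
      (While 4 (Seq (double_reg a 6) (Seq (Add 7 7 7) (Defs.Sub 4 5 6)))).

Definition find_powers :=
  Seq (Seq (Assign 8 1) (Seq (Assign 9 1) (Seq (double_reg d 9) (copy_reg 4 7))))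
      (While 4 (Seq (Add 8 8 8) (Seq (double_reg d 9) (Defs.Sub 4 4 1)))).

(** Register 20 is the guest's register 0. Only the value 1 is acceptance: 0 is rejection, and
    larger values are the output [None]. *)
Definition run_block :=
  Seq (Seq (reset b) (Add 12 11 8))
 (Seq (compile hq gq M)
 (Seq (If 20 (Seq (Defs.Sub 14 20 1) (If 14 Skip (Assign 0 1))) Skip)
 (Seq (Add 10 10 1) (Seq (Add 11 11 9) (Defs.Sub 13 13 1))))).

Definition run_blocks :=
  Seq (Seq (Assign 10 0) (Seq (Assign 11 0) (copy_reg 13 7))) (While 13 run_block).

Definition block_program :=
  Seq find_length
    (If 4 (Seq find_arity
             (Seq (Seq (Assign 5 m0) (Defs.Sub 4 7 5))
                  (If 4 (Seq find_powers run_blocks) Skip)))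
          Skip).

Lemma toss_free_block_program : toss_free block_program.
Proof.
by rewrite /= !toss_free_double_reg toss_free_reset toss_free_compile /access; case: hq.
Qed.

Definition guest_input (m : nat) (t : seq bool) := if gq then nseq m true else t.
Definition guest_oracle (t : seq bool) := if gq then t else [::].

Definition guest_run (m : nat) (t r : seq bool) :=
  run M (guest_input m t) (guest_oracle t) r (T m).

(** A power of two, so that doublings produce it and, for [d > 0], every block starts at a multiple
    of [2 ^ m], as a subcube must. *)
Definition block_size (m : nat) := 2 ^ (d * m.+1).

Definition accepts (m : nat) (w : seq bool) :=
  output (guest_run m (take (2 ^ m) w) (take (T m) (drop (2 ^ m) w))) == Some true.

Definition accepts_block (m : nat) (w : seq bool) (i : nat) :=
  accepts m (drop (i * block_size m) w).

Definition accepts_table (w : seq bool) : bool :=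
  let n := up_log 2 (size w) in let m := block_arity a n in
  [&& size w == 2 ^ n, m0 < m & has (accepts_block m w) (iota 0 m)].

(** * Correctness and running time of the deterministic machine *)

Section Correctness.
Variables (input oracle w : seq bool).
Hypothesis wE : forall y, cell (if hq then oracle else input) y = cell w y.

Let n := up_log 2 (size w).
Let m := block_arity a n.

Lemma size_le_up_log : size w <= 2 ^ n.
Proof.
rewrite /n; case: (leqP (size w) 1) => [|lt1].
  by move: (up_log_gt0 2 (size w)); case: (size w) => [|[]].
by have /andP[] := @up_log_bounds 2 _ isT lt1.
Qed.

Lemma lt_up_log_size j : j < n -> 2 ^ j < size w.
Proof.
rewrite /n => ltj; case: (leqP (size w) 1) => [|lt1].
  by move: ltj; case: (size w) => [|[]]; rewrite ?up_log0 ?up_log1.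
have /andP[lt_pred _] := @up_log_bounds 2 _ isT lt1.
by apply: leq_ltn_trans lt_pred; rewrite leq_exp2l//; lia.
Qed.

Lemma runs_to_find_length s : regs s 0 = 0 -> regs s 3 = 0 ->
  runs_to input oracle find_length (20 * n + 30) (fun s' =>
    [/\ regs s' 0 = 0, regs s' 1 = 1, regs s' 3 = n,
        (regs s' 4 != 0) = (size w == 2 ^ n) & heap s' = heap s]) s.
Proof.
move=> s00 s03.
(* Bits are below the end marker 2, so truncated subtraction detects the end of the string. *)
have subcell y : (2 - cell w y != 0) = (y < size w).
  by rewrite /cell; case: ltnP => //; case: nth.
apply: (@runs_to_effect_seq _ _ (20 * n + 15)) => /=;
  rewrite ?loop_free_access ?program_size_access//; first by lia.
rewrite (effect_access wE); set s1 := set_reg _ _ _.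
pose I j s' := [/\ j <= n, regs s' 2 = 2 ^ (n - j), regs s' 3 = n - j,
    regs s' 4 = 2 - cell w (2 ^ (n - j)) & regs s' 5 = 2] /\
  [/\ regs s' 0 = 0, regs s' 1 = 1 & heap s' = heap s].
apply: (@runs_to_seq _ _ (20 * n + 5) 5); first by lia.
apply: (@runs_to_le _ _ _ (20 * n + 5) _ (I 0)) => //.
  move=> s' [[_ s2 s3 _ s5] [s0 s1' hs]].
  apply: runs_to_effect; rewrite /= ?loop_free_access ?program_size_access//.
  rewrite (effect_access wE) /=; split=> //; first by rewrite s3 subn0.
  rewrite s2 s1' s5 subcell subn0.
  by apply/idP/eqP; have := size_le_up_log; have := expn_gt0 2 n; lia.
apply: (@runs_to_while _ _ I 8 n); first by lia.
- move=> j s' [[ltjn s2 s3 s4 s5] [s0 s1' hs]]; split.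
    by rewrite s4 subcell lt_up_log_size//; lia.
  apply: runs_to_effect; rewrite /= ?loop_free_access ?program_size_access//.
  rewrite (effect_access wE) /= /I /= s2 s3 s1' s5 !addnn -mul2n -expnS.
  by have <- : (n - j.+1).+1 = n - j; [lia|split; split=> //; lia].
- move=> s' [[_ _ _ s4 _] _]; rewrite s4 subn0; apply/eqP.
  by move: (subcell (2 ^ n)); rewrite ltnNge size_le_up_log; case: eqP.
- by rewrite /I /s1 /= subnn.
Qed.

Lemma runs_to_find_arity s : 0 < a -> regs s 1 = 1 -> regs s 3 = n ->
  runs_to input oracle find_arity ((2 * a + 20) * m + 2 * a + 20) (fun s' =>
    [/\ regs s' 0 = regs s 0, regs s' 1 = 1, regs s' 7 = m & heap s' = heap s]) s.
Proof.
move=> a_gt0 s01 s03.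
have lt1 : 1 < 2 ^ a by rewrite -{1}(expn0 2) ltn_exp2l.
pose k := trunc_log (2 ^ a) n; have ltkm : k < m by exact: ltn_expl.
apply: (@runs_to_effect_seq _ _ ((2 * a + 20) * m + 2)) => /=.
- by rewrite loop_free_double_reg.
- by rewrite program_size_double_reg; lia.
set s1 := set_reg _ _ _.
pose I j s' := [/\ j <= k, regs s' 5 = n.+1, regs s' 6 = (2 ^ a) ^ (k - j).+1,
    regs s' 7 = 2 ^ (k - j) & regs s' 4 = n.+1 - (2 ^ a) ^ (k - j).+1] /\
  [/\ regs s' 0 = regs s 0, regs s' 1 = 1 & heap s' = heap s].
apply: (@runs_to_le _ _ _ ((2 * a + 20) * m + 2) _ (I 0)) => //.
  by move=> s' [[_ _ _ s7 _] [s0 s1' hs]]; split=> //; rewrite s7 subn0.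
apply: (@runs_to_while _ _ I (2 * a + 8) k); first by nia.
- move=> j s' [[ltjk s5 s6 s7 s4] [s0 s1' hs]]; split.
    rewrite s4 subn_eq0 -ltnNge ltnS.
    have n_gt0 : 0 < n by case: posnP ltjk => // n0; rewrite /k n0 trunc_log0.
    by apply: leq_trans (trunc_logP lt1 n_gt0); rewrite leq_exp2l//; lia.
  apply: runs_to_effect; rewrite /= ?loop_free_double_reg ?program_size_double_reg//.
    by lia.
  rewrite /I /= !regs_double_reg heap_double_reg /= s5 s6 s7 addnn -mul2n -!expnS.
  by have <- : (k - j.+1).+1 = k - j; [lia|split; split=> //; lia].
- move=> s' [[_ _ _ _ s4] _]; rewrite s4 subn0; apply/eqP; rewrite subn_eq0.
  exact: trunc_log_ltn.
- by rewrite /I /s1 /= !regs_double_reg heap_double_reg /= subnn muln1 expn1 s01 s03 addn1.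
Qed.

Lemma runs_to_find_powers s : regs s 1 = 1 -> regs s 7 = m ->
  runs_to input oracle find_powers ((2 * d + 20) * m + 2 * d + 20) (fun s' =>
    [/\ regs s' 0 = regs s 0, regs s' 1 = 1, regs s' 7 = m, regs s' 8 = 2 ^ m &
        regs s' 9 = block_size m] /\ heap s' = heap s) s.
Proof.
move=> s01 s07.
apply: (@runs_to_effect_seq _ _ ((2 * d + 20) * m + 2)) => /=.
- by rewrite loop_free_double_reg.
- by rewrite program_size_double_reg; lia.
set s1 := set_reg _ _ _.
pose I j s' := [/\ j <= m, regs s' 4 = j, regs s' 8 = 2 ^ (m - j)
    & regs s' 9 = 2 ^ (d * (m - j).+1)] /\
  [/\ regs s' 0 = regs s 0, regs s' 1 = 1, regs s' 7 = m & heap s' = heap s].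
apply: (@runs_to_le _ _ _ ((2 * d + 20) * m + 2) _ (I 0)) => //.
  by move=> s' [[_ _ s8 s9] [s0 s1' s7 hs]]; split=> //; split=> //; rewrite ?s8 ?s9 subn0.
apply: (@runs_to_while _ _ I (2 * d + 8) m); first by nia.
- move=> j s' [[ltjm s4 s8 s9] [s0 s1' s7 hs]]; split; first by rewrite s4.
  apply: runs_to_effect; rewrite /= ?loop_free_double_reg ?program_size_double_reg//.
    by lia.
  rewrite /I /= !regs_double_reg heap_double_reg /= s8 s9 s1' s4 addnn -mul2n.
  rewrite -!expnS -expnD -mulnS.
  by have <- : (m - j.+1).+1 = m - j; [lia|split; split=> //; lia].
- by move=> s' [[]].
- by rewrite /I /s1 /= !regs_double_reg heap_double_reg /= subnn !muln1 s01 s07.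
Qed.

Hypotheses (b_gt0 : 0 < b) (Mb : registers_below b M) (a_gt0 : 0 < a).
Hypothesis M_halts : forall k t r, m0 < k -> size t = 2 ^ k -> size r = T k ->
  halted (guest_run k t r).
Hypothesis block_fits : forall k, m0 < k -> 2 ^ k + T k <= block_size k.
Hypothesis blocks_fit :
  forall l, m0 < block_arity a l -> block_arity a l * block_size (block_arity a l) <= 2 ^ l.

Definition block_time k := (4 * k + 30) * T k + 2 * b + 30.

Lemma runs_to_run_blocks s : size w = 2 ^ n -> m0 < m ->
  regs s 0 = 0 -> regs s 1 = 1 -> regs s 7 = m -> regs s 8 = 2 ^ m ->
  regs s 9 = block_size m -> heap s = (fun=> 0) ->
  runs_to input oracle run_blocks (m * (block_time m).+1 + 20)
    (fun s' => regs s' 0 = has (accepts_block m w) (iota 0 m)) s.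
Proof.
move=> szw lt0m s00 s01 s07 s08 s09 hs.
apply: (@runs_to_effect_seq _ _ (m * (block_time m).+1 + 5)) => //=; first by lia.
set s1 := set_reg _ _ _.
(* With [j] blocks left, register 0 records the first [m - j] blocks, and only the heap cells of the
   remaining runs are known to be empty. *)
pose I j s' := [/\ j <= m,
    regs s' 0 = has (accepts_block m w) (iota 0 (m - j)), regs s' 10 = m - j,
    regs s' 11 = (m - j) * block_size m & regs s' 13 = j] /\
  [/\ regs s' 1 = 1, regs s' 7 = m, regs s' 8 = 2 ^ m, regs s' 9 = block_size m &
    forall k y, m - j <= k < m -> heap s' (k + m * y) = 0].
apply: (@runs_to_le _ _ _ (m * (block_time m).+1 + 5) _ (I 0)) => //.
  by move=> s' [[_ ->]]; rewrite subn0.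
apply: (@runs_to_while _ _ I (block_time m) m); first by lia.
- move=> j s' [[ltjm s0 s10 s11 s13] [s1' s7 s8 s9 hp]]; split; first by rewrite s13.
  apply: (@runs_to_effect_seq _ _ ((4 * m + 30) * T m + 20)) => /=.
  + by rewrite loop_free_reset.
  + by rewrite program_size_reset /block_time; lia.
  set s2 := set_reg _ _ _; set i := m - j.+1 in s0 s10 s11 hp.
  have le_seg : i * block_size m + 2 ^ m + T m <= size w.
    rewrite szw (leq_trans _ (blocks_fit lt0m))// -/m -addnA.
    have ltim : i < m by rewrite /i; lia.
    apply: (@leq_trans (i.+1 * block_size m)); last by rewrite leq_mul2r ltim orbT.
    by rewrite mulSn addnC leq_add2r block_fits.
  have s2E z : z < 20 -> z != 12 -> regs s2 z = regs s' z.
    by move=> ltz /negbTE nz; rewrite /s2 /= nz regs_reset_host.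
  have s2_12 : regs s2 12 = i * block_size m + 2 ^ m.
    by rewrite /s2 /= !regs_reset_host// s11 s8.
  have hlt : halted (guest_run m (take (2 ^ m) (drop (i * block_size m) w))
                       (take (T m) (drop (i * block_size m + 2 ^ m) w))).
    by apply: M_halts => //; rewrite size_takel// size_drop; lia.
  have ltim : i < m by rewrite /i; lia.
  apply: (@runs_to_seq _ _ ((4 * m + 30) * T m) 15); first by lia.
  have := runs_to_compile wE ltim le_seg (s0 := s2) _ _ _ _ _ s2_12 Mb _ _ hlt.
  rewrite !s2E// => /(_ s1' s7 s8 s10 s11) runM.
  have guest0 x : x < b -> regs s2 (guest x) = 0.
    by move=> ltxb; rewrite /s2 /= regs_reset_guest.
  have heap0 k y : i <= k < m -> heap s2 (k + m * y) = 0.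
    by rewrite /s2 /= heap_reset; exact: hp.
  apply: runs_to_le (runM guest0 heap0) => // s3 [s3g s3h s3hp].
  have {}s3h z : z < 20 -> z \notin [:: 12; 14; 15] -> regs s3 z = regs s' z.
    by move=> ltz nz; rewrite s3h// s2E//; apply: contraNneq nz => ->.
  have s3_20 : regs s3 20 = regs (guest_run m (take (2 ^ m) (drop (i * block_size m) w))
                       (take (T m) (drop (i * block_size m + 2 ^ m) w))).2 0.
    exact: (s3g 0).
  have accE : accepts_block m w i = (regs s3 20 == 1).
    rewrite /accepts_block /accepts drop_drop [2 ^ m + _]addnC /output s3_20.
    by case: regs => [|[]].
  apply: runs_to_effect => //.
  have iS : m - j = i.+1 by rewrite /i; lia.
  have hasE : has (accepts_block m w) (iota 0 (m - j)) =
              has (accepts_block m w) (iota 0 i) || (regs s3 20 == 1).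
    by rewrite iS -addn1 iotaD has_cat /= orbF add0n accE.
  have [t0 t1 t7 t8 t9] : [/\ regs s3 0 = has (accepts_block m w) (iota 0 i),
      regs s3 1 = 1, regs s3 7 = m, regs s3 8 = 2 ^ m & regs s3 9 = block_size m].
    by rewrite !s3h.
  have [t10 t11 t13] :
      [/\ regs s3 10 = i, regs s3 11 = i * block_size m & regs s3 13 = j.+1].
    by rewrite !s3h.
  have jS : j.+1 - 1 = j by rewrite subn1.
  rewrite /I hasE iS /=; case: (regs s3 20) => [|[|v]] /=;
    rewrite ?t0 ?t1 ?t7 ?t8 ?t9 ?t10 ?t11 ?t13 /= ?t1 ?t13 ?t10 ?t11 ?t9 jS ?orbT ?orbF;
    by split; split; rewrite ?addn1 ?mulSn 1?[block_size m + _]addnC ?(ltnW ltjm).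
- by move=> s' [[]].
- rewrite /I /s1 /= subnn hs s00 s01 s07 s08 s09; by [].
Qed.

Definition block_program_time k l :=
  20 * (l + 2) + (2 * (a + d + b) + 100) * (k + 3) + k * ((4 * k + 30) * T k).

(** On a length that is not a power of two the machine stops after [find_length]. The final time
    bound uses [trunc_log], which may then be smaller than [n], so this case needs its own
    estimate. *)
Lemma runs_to_block_program r :
  runs_to input oracle block_program
   (if size w == 2 ^ n then block_program_time m n else 20 * (n + 2))
   (fun s => regs s 0 = accepts_table w) (State (fun=> 0) (fun=> 0) r).
Proof.
rewrite /accepts_table -/n -/m; pose C := (2 * (a + d + b) + 100) * (m + 3) +
  m * ((4 * m + 30) * T m).
apply: (@runs_to_seq _ _ (20 * n + 30) (if size w == 2 ^ n then C else 5)).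
  by case: eqP => _; rewrite /C /block_program_time; lia.
apply: runs_to_le (runs_to_find_length _ _) => // s [s0 s1 s3 s4 hs].
apply: (@runs_to_if _ _ (if size w == 2 ^ n then C.-1 else 4)).
  by case: eqP => _; rewrite /C; lia.
rewrite s4; case: eqP => szw /=; last by apply: runs_to_effect.
have m_gt0 : 0 < m by rewrite expn_gt0.
apply: (@runs_to_seq _ _ ((2 * a + 20) * m + 2 * a + 20)
  ((2 * (d + b) + 60) * (m + 2) + m * ((4 * m + 30) * T m) + 10)).
  by rewrite /C; nia.
apply: runs_to_le (runs_to_find_arity a_gt0 s1 s3) => // s' [s'0 s'1 s'7 hs'].
apply: (@runs_to_effect_seq _ _
  ((2 * (d + b) + 60) * (m + 2) + m * ((4 * m + 30) * T m) + 5)) => //=.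
  by lia.
apply: (@runs_to_if _ _
  ((2 * (d + b) + 60) * (m + 2) + m * ((4 * m + 30) * T m) + 4)); first by lia.
rewrite /= subn_eq0 -ltnNge s'7; case: ifP => lt0m; last first.
  by apply: runs_to_effect; rewrite //= ?s'0 ?s0//; lia.
apply: (@runs_to_seq _ _ ((2 * d + 20) * m + 2 * d + 20)
  (m * (block_time m).+1 + 20)); first by rewrite /block_time; nia.
set s2 := set_reg _ _ _.
apply: runs_to_le (@runs_to_find_powers s2 _ _) => //.
move=> s3' [[t0 t1 t7 t8 t9] ht].
apply: runs_to_run_blocks => //; first by rewrite t0 /s2 /= s'0.
by rewrite ht /s2 /= hs' hs.
Qed.

Lemma run_block_program B r : 20 * (n + 2) <= B -> 
  (size w = 2 ^ n -> block_program_time m n <= B) ->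
  halted (run block_program input oracle r B) /\
  output (run block_program input oracle r B) = Some (accepts_table w).
Proof.
move=> leB leB'.
have [|hlt out] := @runs_to_run input oracle block_program B
  (fun s => regs s 0 = accepts_table w) r.
  by apply: runs_to_le (runs_to_block_program r) => //; case: eqP => // /leB'.
by split=> //; rewrite /output out; case: (accepts_table w).
Qed.

End Correctness.
End Main.

(** * Counting *)

(** Counting strings replaces probabilities over [n] uniform bits and keeps the estimates in the
    natural numbers. *)
Definition count_words (n : nat) (p : pred (seq bool)) : nat :=
  #|[pred w : n.-tuple bool | p w]|.

Lemma count_wordsE n p : count_words n p = \sum_(w : n.-tuple bool) p w.
Proof. by rewrite /count_words -sum1_card big_mkcond. Qed.

Lemma count_words_le n p : count_words n p <= 2 ^ n.
Proof. by rewrite (leq_trans (max_card _))// card_tuple card_bool. Qed.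

Lemma eq_count_words n (p q : pred (seq bool)) :
  (forall w, size w = n -> p w = q w) -> count_words n p = count_words n q.
Proof. by move=> eqpq; apply: eq_card => w; rewrite !inE eqpq ?size_tuple. Qed.

Lemma count_words_and n (c : bool) p :
  count_words n (fun w => c && p w) = c * count_words n p.
Proof.
rewrite !count_wordsE big_distrr; apply: eq_bigr => w _.
by rewrite /= mulnb.
Qed.

Lemma count_words_const n (c : bool) : count_words n (fun=> c) = c * 2 ^ n.
Proof. by rewrite count_wordsE sum_nat_const card_tuple card_bool mulnC. Qed.

Lemma count_words_cat n1 n2 p : count_words (n1 + n2) p =
  \sum_(x : n1.-tuple bool) count_words n2 (fun y => p (x ++ y)).
Proof.
under eq_bigr do rewrite count_wordsE.
rewrite count_wordsE pair_big /=.
pose h (xy : n1.-tuple bool * n2.-tuple bool) := cat_tuple xy.1 xy.2.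
rewrite (reindex h) //=; apply: onW_bij; apply: inj_card_bij; last first.
  by rewrite card_prod !card_tuple expnD.
move=> [x y] [x' y'] /(congr1 val)/eqP /=.
rewrite eqseq_cat ?size_tuple// => /andP[/eqP eqx /eqP eqy].
by congr pair; apply: val_inj.
Qed.

(** Independence of the blocks: [p] depends on the first [D] bits only, so it holds on [K] disjoint
    blocks independently, and the last [rest] bits are free. *)
Lemma count_words_blocks (p : pred (seq bool)) D rest K :
  (forall x y, size x = D -> p (x ++ y) = p x) ->
  count_words (K * D + rest) (fun w => all (fun i => p (drop (i * D) w)) (iota 0 K)) =
  count_words D p ^ K * 2 ^ rest.
Proof.
move=> p_local; elim: K => [|K IHK].
  by rewrite mul0n mul1n add0n /= count_words_const mul1n.
rewrite mulSn -addnA count_words_cat expnS -mulnA -IHK.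
rewrite [count_words D p]count_wordsE big_distrl /=; apply: eq_bigr => x _.
rewrite -count_words_and; apply: eq_count_words => y _.
rewrite /= mul0n drop0 p_local ?size_tuple//.
congr (_ && _); rewrite -[1]addn0 iotaDl all_map; apply: eq_all => i /=.
by rewrite mulSn addnC -drop_drop drop_size_cat ?size_tuple.
Qed.

(** Bernoulli's inequality (3/2)^k >= 1 + k/2 weakens the fraction (2/3)^k to 2/(k+2), which still
    tends to 0. *)
Lemma two_thirds_power k F x : 3 ^ k * x <= 2 ^ k * F -> (k + 2) * x <= 2 * F.
Proof.
have bernoulli : (k + 2) * 2 ^ k <= 2 * 3 ^ k.
  by elim: k => // k IHk; rewrite !expnS; nia.
move=> le_xF; rewrite -(@leq_pmul2l (2 ^ k)) ?expn_gt0//.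
have := leq_mul bernoulli (leqnn x); have := leq_mul (leqnn 2) le_xF; lia.
Qed.

Lemma card_bfun n : #|bfun n| = 2 ^ 2 ^ n.
Proof. by rewrite card_ffun card_tuple card_bool. Qed.

(** * Derandomization of a sampler by the blocks of a truth table *)

Section Sampler.
Variables (gq : bool) (M : program) (T : nat -> nat) (e : nat).

(* [gq] tells whether [M] is given the truth table of [g] as its oracle or as its
   input. *)
Record sampler (K : typical_class) (c k m0 : nat) (S : property) : Prop := Sampler {
  sampler_time : forall m, T m <= 2 ^ (e * m.+1);
  sampler_halts : forall m t r, m0 < m -> size t = 2 ^ m -> size r = T m ->
    halted (guest_run gq M T m t r);
  sampler_sound : forall m (g : bfun m) r, m0 < m -> size r = T m ->
    computable_in K c (m ^ k) g ->
    output (guest_run gq M T m (truth_table g) r) != Some true;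
  sampler_dense : forall m, m0 < m -> #|bfun m| <= 2 * #|S m|;
  sampler_complete : forall m (g : bfun m), m0 < m -> g \in S m ->
    3 * count_words (T m)
      (fun r => output (guest_run gq M T m (truth_table g) r) != Some true) <= 2 ^ T m }.

Variables (K : typical_class) (c k m0 : nat) (S : property).
Hypothesis smp : sampler K c k m0 S.

Let rejects m w := ~~ accepts gq M T m w.

(** On [S], which has density at least 1/2, at most 1/3 of the coin sequences fail; elsewhere all
    may. The rejected fraction is thus at most 1/2 * 1/3 + 1/2 = 2/3. *)
Lemma count_rejects m rest : m0 < m ->
  3 * count_words (2 ^ m + (T m + rest)) (rejects m) <=
  2 * 2 ^ (2 ^ m + (T m + rest)).
Proof.
move=> lt0m; rewrite count_words_cat.
have [h1 h1K hK1] := truth_table_bij m.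
rewrite (reindex (@truth_table_tuple m)) /=; last by apply: onW_bij; exists h1.
pose N (g : bfun m) := count_words (T m)
  (fun r => output (guest_run gq M T m (truth_table g) r) != Some true).
rewrite (eq_bigr (fun g => N g * 2 ^ rest)); last first.
  move=> g _; rewrite count_words_cat /N count_wordsE big_distrl /=.
  apply: eq_bigr => r _; rewrite -count_words_const; apply: eq_count_words => z _.
  rewrite /rejects /accepts.
  rewrite take_size_cat ?size_truth_table// drop_size_cat ?size_truth_table//.
  by rewrite take_size_cat ?size_tuple.
rewrite -big_distrl /= !expnD !mulnA leq_mul2r; apply/orP; right.
(* The weights are three times the failure bounds: 1/3 on [S] and 1 outside. *)
have leN : 3 * \sum_g N g <= \sum_(g : bfun m) (if g \in S m then 1 else 3) * 2 ^ T m.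
  rewrite big_distrr /=; apply: leq_sum => g _; case: ifP => gS.
    by rewrite mul1n; exact: (sampler_complete smp).
  by rewrite leq_mul2l count_words_le.
apply: leq_trans leN _; rewrite -big_distrl leq_mul2r; apply/orP; right => /=.
have weights : \sum_(g : bfun m) (if g \in S m then 1 else 3) + 2 * #|S m| = 3 * 2 ^ 2 ^ m.
  rewrite -sum1_card [\sum_(_ in _) _]big_mkcond big_distrr -big_split /=.
  rewrite (eq_bigr (fun=> 3)); last by move=> g _; case: ifP.
  by rewrite sum_nat_const card_bfun mulnC.
have conclude x y z : x + 2 * y = 3 * z -> z <= 2 * y -> x <= 2 * z by lia.
by apply: conclude weights _; rewrite -card_bfun; exact: (sampler_dense smp).
Qed.

Variables (a b : nat).
Hypothesis a_gt1 : 1 < a.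

Let d := e.+1.
(** Beyond [m0] the sampler works, and [m > 2 * d + 2] ensures [m + d * m.+1 <= m ^ 2], so that [m]
    blocks fit into the table. *)
Let m1 := m0 + 2 * d + 2.
Let table := accepts_table gq M a d m1 T.

Lemma lt_block_arity n : n < (2 * block_arity a n) ^ a.
Proof.
have lt1 : 1 < 2 ^ a by rewrite -{1}(expn0 2) ltn_exp2l// ltnW.
by rewrite /block_arity -expnS -expnM mulnC expnM trunc_log_ltn.
Qed.

Lemma block_arity_le n : 0 < n -> block_arity a n ^ a <= n.
Proof.
have lt1 : 1 < 2 ^ a by rewrite -{1}(expn0 2) ltn_exp2l// ltnW.
by move=> n_gt0; rewrite /block_arity -expnM mulnC expnM trunc_logP.
Qed.

Lemma block_arity_gt0 n : 0 < block_arity a n.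
Proof. by rewrite expn_gt0. Qed.

Lemma lt_block_arity_log l n : (2 ^ a) ^ l <= n -> l < block_arity a n.
Proof.
have lt1 : 1 < 2 ^ a by rewrite -{1}(expn0 2) ltn_exp2l// ltnW.
by move=> /(trunc_log_max lt1) /leq_ltn_trans; apply; exact: ltn_expl.
Qed.

(** Table and coins take at most 2^(e(m+1)+m) bits each, and twice this is exactly one block. *)
Lemma block_fits m : 2 ^ m + T m <= block_size d m.
Proof.
apply: leq_trans (_ : 2 ^ (e * m.+1 + m) + 2 ^ (e * m.+1 + m) <= _).
  apply: leq_add; first by rewrite leq_exp2l// leq_addl.
  by apply: leq_trans (sampler_time smp m) _; rewrite leq_exp2l// leq_addr.
by rewrite addnn -mul2n -expnS leq_exp2l// /d mulSn; lia.
Qed.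

(** The chain is m * 2^(d(m+1)) <= 2^(m + d(m+1)) <= 2^(m^2) <= 2^(m^a) <= 2^l, where the third
    inequality uses [1 < a]. *)
Lemma blocks_fit l : m1 < block_arity a l ->
  block_arity a l * block_size d (block_arity a l) <= 2 ^ l.
Proof.
set m := block_arity a l => lt1m.
have l_gt0 : 0 < l by case: posnP lt1m => // l0; rewrite /m /block_arity l0 trunc_log0; lia.
apply: (@leq_trans (2 ^ m * 2 ^ (d * m.+1))).
  by rewrite leq_mul2r (ltnW (ltn_expl _ _)) ?orbT.
rewrite -expnD leq_exp2l//; apply: leq_trans (block_arity_le l_gt0); rewrite -/m.
apply: (@leq_trans (m ^ 2)); first by rewrite /m1 in lt1m; rewrite -mulnn; nia.
by rewrite leq_exp2l//; lia.
Qed.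

Lemma accepts_table_size w : table w -> exists n, size w = 2 ^ n.
Proof. by case/and3P=> /eqP-> _ _; exists (up_log 2 (size w)). Qed.

Definition block_property : property := fun n => [set f | table (truth_table f)].

Lemma accepts_tableE w : table w = `[< property_language block_property w >].
Proof.
apply/idP/asboolP => [wt|[n [f [fR ->]]]]; last by rewrite inE in fR.
have [n szw] := accepts_table_size wt; have [f fw] := truth_table_onto szw.
by exists n, f; rewrite inE fw.
Qed.

Lemma up_log_size_truth_table n (f : bfun n) : up_log 2 (size (truth_table f)) = n.
Proof. by rewrite size_truth_table up_expnK. Qed.

Lemma accepts_table_truth_table n (f : bfun n) : table (truth_table f) =
  (m1 < block_arity a n) &&
  has (accepts_block gq M d T (block_arity a n) (truth_table f)) (iota 0 (block_arity a n)).
Proof. by rewrite /table /accepts_table up_log_size_truth_table size_truth_table eqxx. Qed.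

(** An accepted block begins with the table of a restriction of [f] to [m] variables. As n < (2m)^a
    <= m^(2a), a circuit of size n^k' for [f] would give one of size m^(2ak') for the restriction,
    against soundness. *)
Lemma block_property_useful c' k' n (f : bfun n) :
  0 < k' -> c = c' * (2 * a) -> k = 2 * a * k' ->
  f \in block_property n -> ~ computable_in K c' (n ^ k') f.
Proof.
move=> k'_gt0 c'E k'E; rewrite inE accepts_table_truth_table.
set m := block_arity a n => /andP[lt1m] /hasP[i]; rewrite mem_iota add0n /= => ltim accf compf.
have lt0m : m0 < m by rewrite /m1 in lt1m; lia.
have dvd_D : 2 ^ m %| i * block_size d m.
  by rewrite dvdn_mull// dvdn_exp2l// /d mulSn; lia.
have le_D : (i + 1) * block_size d m <= 2 ^ n.
  by apply: leq_trans (blocks_fit lt1m); rewrite -/m leq_mul2r addn1 ltim orbT.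
have le_z : i * block_size d m + 2 ^ m <= 2 ^ n.
  by apply: leq_trans le_D; rewrite mulnDl mul1n leq_add2l; have := block_fits m; lia.
have n_le : n <= m ^ (2 * a).
  apply: ltnW; apply: leq_trans (lt_block_arity n) _.
  by rewrite expnM leq_exp2r ?(ltnW a_gt1)// -mulnn leq_mul2r; rewrite /m1 -/m in lt1m *; lia.
move: accf; rewrite /accepts_block /accepts -truth_table_subcube//.
apply/negP; apply: (sampler_sound smp) => //.
  rewrite size_takel// !size_drop size_truth_table; have := block_fits m.
  by move: le_D; rewrite mulnDl mul1n; lia.
apply: computable_in_subcube compf.
- by rewrite c'E; nia.
(* The depth bound of NC1: log n is at most 2a log m. *)
- rewrite c'E -mulnA leq_mul2l; apply/orP; right.
  apply: up_log_min => //; rewrite mulnC expnM; apply: leq_trans n_le _.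
  by rewrite leq_exp2r ?up_logP//; lia.
- by rewrite k'E expnM leq_exp2r.
Qed.

(** A function outside the property has all its [m] independent blocks rejected, each with
    probability at most 2/3. *)
Lemma block_property_dense n : m1 < block_arity a n ->
  (block_arity a n + 2) * #|~: block_property n| <= 2 * #|bfun n|.
Proof.
set m := block_arity a n => lt1m; apply: two_thirds_power.
have lt0m : m0 < m by rewrite /m1 in lt1m; lia.
have -> : #|~: block_property n| = count_words (2 ^ n) (fun w =>
    all (fun i => rejects m (drop (i * block_size d m) w)) (iota 0 m)).
  have [h hK Kh] := truth_table_bij n.
  rewrite /count_words -[LHS](card_imset _ (can_inj hK)); apply: eq_card => w.
  rewrite inE -[w]Kh (mem_imset _ _ (can_inj hK)) !inE accepts_table_truth_table.
  by rewrite -/m lt1m -all_predC.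
rewrite -(subnKC (blocks_fit lt1m)) -/m; set rest := _ - _.
(* A run sees only the first [2 ^ m + T m] bits, which lie inside its block. *)
rewrite count_words_blocks; last first.
  move=> x y szx; rewrite /rejects /accepts; have fits := block_fits m.
  rewrite takel_cat; last by lia.
  rewrite -{2}(cat_take_drop (2 ^ m) x) -catA drop_size_cat ?size_takel//; last by lia.
  by rewrite takel_cat// size_drop; lia.
rewrite mulnA -expnMn card_bfun -(subnKC (blocks_fit lt1m)) -/m -/rest.
rewrite expnD mulnA leq_mul2r [m * _]mulnC expnM -expnMn leq_exp2r ?lt0m; last by lia.
apply/orP; right; move: (block_fits m) => fits; rewrite -(subnKC fits) -addnA.
exact: count_rejects.
Qed.

Lemma block_program_time_le : exists C, forall l,
  20 * (l + 3) <= C * 2 ^ (C * block_arity a l) /\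
  block_program_time b a d T (block_arity a l) l <= C * 2 ^ (C * block_arity a l).
Proof.
pose A := 2 * (a + d + b) + 100; pose E := 2 * a + 2 * e + 2.
(* The terms linear in [l] contribute 60, the simulated runs 34, the loops [4 * A], and [E] bounds
   the exponent. *)
exists (94 + 4 * A + E) => l; set m := block_arity a l.
have m_gt0 : 0 < m := block_arity_gt0 l.
have leC C0 : C0 <= 94 + 4 * A ->
    C0 * 2 ^ (E * m) <= (94 + 4 * A + E) * 2 ^ ((94 + 4 * A + E) * m).
  by move=> leC0; rewrite leq_mul ?leq_exp2l ?leq_mul2r; lia.
have ltm : m < 2 ^ m by exact: ltn_expl.
have le_l : l < 2 ^ (E * m).
  apply: leq_trans (lt_block_arity l) _; rewrite -/m.
  apply: (@leq_trans ((2 ^ (2 * m)) ^ a)).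
    by rewrite leq_exp2r ?(ltnW a_gt1)// ltnW// ltn_expl.
  by rewrite -expnM leq_exp2l// /E; nia.
have le_m : m + 3 <= 4 * 2 ^ (E * m).
  have : 2 ^ m <= 2 ^ (E * m) by rewrite leq_exp2l// /E; nia.
  by lia.
have le_T : m * ((4 * m + 30) * T m) <= 34 * 2 ^ (E * m).
  apply: (@leq_trans (2 ^ m * (34 * 2 ^ m * 2 ^ (e * m.+1)))).
    apply: leq_mul; first exact: ltnW.
    by apply: leq_mul; [lia | exact: sampler_time smp m].
  rewrite mulnA [2 ^ m * (34 * _)]mulnCA -mulnA leq_mul2l /= -!expnD leq_exp2l// /E; nia.
rewrite /block_program_time -/A; clearbody A E.
move: (leC _ (leqnn _)) (leC 60) le_l le_m le_T.
move: (2 ^ (E * m)) (m * (_ * T m)) => X Y leAX le60X le_l le_m le_Y; split.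
  by apply: (leq_trans _ (le60X _)); lia.
by apply: (leq_trans _ leAX); have := leq_mul (leqnn A) le_m; lia.
Qed.

Lemma run_block_program_property : 0 < b -> registers_below b M ->
  exists C, forall hq input oracle w r B,
  (forall y, cell (if hq then oracle else input) y = cell w y) ->
  C * 2 ^ (C * block_arity a (trunc_log 2 (size w))) <= B ->
  halted (run (block_program hq gq M b a d m1) input oracle r B) /\
  output (run (block_program hq gq M b a d m1) input oracle r B) =
    Some `[< property_language block_property w >].
Proof.
move=> b_gt0 Mb; have [C leC] := block_program_time_le.
exists C => hq input oracle w r B wE leB.
rewrite -accepts_tableE; apply: (run_block_program wE b_gt0 Mb (ltnW a_gt1)).
- move=> k0 t r0 lt1k; apply: (sampler_halts smp); rewrite /m1 in lt1k; lia.
- by move=> k0 _; exact: block_fits.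
- exact: blocks_fit.
(* For an arbitrary length, [up_log] may exceed [trunc_log] by 1, whence [l + 3] in the time
   bound. *)
- apply: leq_trans leB; apply: leq_trans (proj1 (leC _)).
  have : up_log 2 (size w) <= (trunc_log 2 (size w)).+1.
    by apply: up_log_min => //; rewrite ltnW ?trunc_log_ltn.
  by rewrite leq_mul2l /=; lia.
- move=> szw; apply: leq_trans leB; move: (proj2 (leC (trunc_log 2 (size w)))).
  by rewrite [in X in X <= _]szw [trunc_log 2 (2 ^ _)]trunc_expnK// szw up_expnK// trunc_expnK.
Qed.

End Sampler.

(** The common ground of ZPP-natural proofs and distinguishers, from which both deterministic
    constructions start. *)
Definition has_samplers (K : typical_class) := forall c k, 0 < k ->
  exists gq M T e m0 S, @sampler gq M T e K c k m0 S.

(** The sampler is taken for [c * (2 * a)] and [2 * a * k] to pay for the passage from [n] to [m]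
    variables. One property serves both values of [hq]: it is decided alike from the input and from
    the oracle. *)
Lemma deterministic_property K a c k : has_samplers K -> 1 < a -> 0 < k ->
  exists (Rn : property) (A : bool -> program) (C : nat),
  [/\ forall hq, toss_free (A hq),
      forall hq input oracle w r B,
        (forall y, cell (if hq then oracle else input) y = cell w y) ->
        C * 2 ^ (C * block_arity a (trunc_log 2 (size w))) <= B ->
        halted (run (A hq) input oracle r B) /\
        output (run (A hq) input oracle r B) = Some `[< property_language Rn w >],
      forall n (f : bfun n), f \in Rn n -> ~ computable_in K c (n ^ k) f &
      forall l, exists n1, forall n, n1 <= n -> l * #|~: Rn n| <= 2 * #|bfun n|].
Proof.
move=> smps a_gt1 k_gt0.
have k'_gt0 : 0 < 2 * a * k by nia.
have [gq [M [T [e [m0 [S smp]]]]]] := smps (c * (2 * a)) _ k'_gt0.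
have [b [b_gt0 Mb]] := ex_registers_below M.
have [C runs] := run_block_program_property smp a_gt1 b_gt0 Mb.
exists (block_property gq M T e m0 a),
  (fun hq => block_program hq gq M b a e.+1 (m0 + 2 * e.+1 + 2)), C; split=> //.
- by move=> hq; exact: toss_free_block_program.
- by move=> n f; exact: (block_property_useful smp a_gt1 k_gt0).
move=> l; pose l' := m0 + 2 * e.+1 + 2 + l.
exists ((2 ^ a) ^ l') => n /(lt_block_arity_log a_gt1) lt_l'.
apply: leq_trans (block_property_dense smp a_gt1 _); last by lia.
by rewrite leq_mul2r; apply/orP; right; lia.
Qed.

(** * The equivalences *)

Lemma Pr_ge_half (X : finType) (A : {set X}) :
  (1 / 2%:R <= Pr [pred x | x \in A])%R -> #|X| <= 2 * #|A|.
Proof.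
rewrite /Pr; have [->//|X_gt0] := posnP #|{: X}|.
rewrite ler_pdivlMr ?ltr0n// mulrAC ler_pdivrMr ?ltr0n// mul1r -natrM ler_nat.
by rewrite mulnC.
Qed.

Lemma Pr_ge_complement (X : finType) (A : {set X}) (delta : rat) (l : nat) :
  0 < #|X| -> 0 < l -> (2%:R <= delta * l%:R)%R -> l * #|~: A| <= 2 * #|X| ->
  (1 - delta <= Pr [pred x | x \in A])%R.
Proof.
move=> X_gt0 l_gt0 le_delta; rewrite /Pr -(ler_nat rat) !natrM => le_l.
have X0 : (0 < #|{: X}|%:R :> rat)%R by rewrite ltr0n.
have l0 : (0 < l%:R :> rat)%R by rewrite ltr0n.
have XE : (#|{: X}|%:R = #|A|%:R + #|~: A|%:R :> rat)%R by rewrite -natrD cardsC.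
have le_compl : (#|~: A|%:R <= delta * #|{: X}|%:R)%R.
  rewrite -(ler_pM2l l0); apply: le_trans le_l _.
  by rewrite mulrCA mulrA ler_pM2r// mulrC.
rewrite ler_pdivlMr//.
have -> : #|[pred x | x \in A]| = #|A| by [].
by rewrite mulrBl mul1r; lra.
Qed.

Lemma halts_within_size M input oracle B r :
  halts_within M input oracle B -> size r = B -> halted (run M input oracle r B).
Proof. by move=> hlt /eqP szr; exact: (hlt (Tuple szr)). Qed.

Lemma zero_error_false M input oracle B r :
  zero_error_output M input oracle B false -> size r = B ->
  output (run M input oracle r B) != Some true.
Proof. by move=> [out _] /eqP szr; have [/=->|/=->] := out (Tuple szr). Qed.

(** Without errors, not accepting means the output [None], which has probability at most 1/3. *)
Lemma zero_error_true M input oracle B :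
  zero_error_output M input oracle B true ->
  3 * count_words B (fun r => output (run M input oracle r B) != Some true) <= 2 ^ B.
Proof.
move=> [out]; rewrite /Pr card_tuple card_bool.
rewrite ler_pdivrMr ?ltr0n ?expn_gt0// mulrC mul1r ler_pdivlMr ?ltr0n//.
rewrite -natrM ler_nat mulnC; apply: leq_trans; rewrite leq_mul2l /=.
by apply: subset_leq_card; apply/fintype.subsetP => r; rewrite !inE; have [->|->] := out r.
Qed.

(** The input is a table of length [2 ^ m], so polynomial time is 2^O(m), and the property itself
    serves as [S]. *)
Lemma ZPP_samplers K : natural_proofs_poly ZPP K -> has_samplers K.
Proof.
move=> nat_K c k k_gt0; have [Rn [n0 [[k1 [M zpM]] dense useful]]] := nat_K c k k_gt0.
exists false, M, (fun m => (2 ^ m) ^ k1 + k1), k1.+1, n0, Rn; split.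
- move=> m; apply: (@leq_trans (2 ^ (k1 * m.+1) + 2 ^ (k1 * m.+1))).
    apply: leq_add; first by rewrite -expnM leq_exp2l// mulnC leq_mul2l leqnSn orbT.
    apply: ltnW; apply: leq_trans (ltn_expl k1 (isT : 1 < 2)) _.
    by rewrite leq_exp2l// mulnS leq_addr.
  by rewrite addnn -mul2n -expnS leq_exp2l// [k1.+1 * _]mulSn; lia.
- move=> m t r _ szt szr; have [hlt _] := zpM t; rewrite szt in hlt.
  exact: halts_within_size hlt szr.
- move=> m g r lt0m szr easy; have [_] := zpM (truth_table g).
  rewrite size_truth_table (_ : `[< _ >] = false); first by move/zero_error_false; exact.
  by apply/asboolP => /property_languageP/(useful _ (ltnW lt0m)).
- by move=> m /ltnW/dense/Pr_ge_half.
- move=> m g _ gR; have [_] := zpM (truth_table g).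
  rewrite size_truth_table (_ : `[< _ >] = true); first exact: zero_error_true.
  by apply/asboolP/property_languageP.
Qed.

Lemma natural_proofs_poly_sub (D D' : language -> Prop) K :
  (forall L, D L -> D' L) -> natural_proofs_poly D K -> natural_proofs_poly D' K.
Proof.
move=> subD nat_K c k /(nat_K c) [Rn [n0 [RD dense useful]]].
by exists Rn, n0; split=> //; exact: subD.
Qed.

(** The two runs proceed in lockstep, in states that differ at most in their coins. *)
Lemma run_toss_free M input oracle r r' t : toss_free M ->
  halted (run M input oracle r t) = halted (run M input oracle r' t) /\
  output (run M input oracle r t) = output (run M input oracle r' t).
Proof.
pose same (c1 c2 : config) :=
  [/\ c1.1 = c2.1, all toss_free c1.1, regs c1.2 = regs c2.2 & heap c1.2 = heap c2.2].
move=> tfM.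
suff [eq1 _ eq2 _] : same (run M input oracle r t) (run M input oracle r' t).
  by rewrite /halted /output eq1 eq2.
rewrite /run; elim: t => [|t]; first by split; rewrite //= tfM.
rewrite !iterS; case: (iter t _ _) => k1 [rg1 hp1 co1].
case: (iter t _ _) => k2 [rg2 hp2 co2] [/= <- + <- <-].
case: k1 => [|p k] //= /andP[+ tfk]; case: p => //=.
- by move=> p q /andP[tfp tfq]; split; rewrite //= tfp tfq.
- by move=> x p q /andP[tfp tfq]; split=> //=; case: ifP; rewrite ?tfp ?tfq.
- by move=> x p tfp; split=> //=; case: ifP; rewrite //= tfp.
Qed.

Lemma P_sub_ZPP L : P L -> ZPP L.
Proof.
move=> [k [M tfM decM]]; exists k, M => w; have [hlt out] := decM w.
have same r := run_toss_free w [::] r [::] (size w ^ k + k) tfM.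
split; first by move=> r; have [-> _] := same r.
split=> [r|]; first by left; have [_ ->] := same r.
rewrite /Pr (eq_card0 (A := [pred r | _])) ?mul0r// => r.
by rewrite !inE; have [_ ->] := same r; rewrite out.
Qed.

Lemma DTIME_leq T T' L : (forall N, T N <= T' N) -> DTIME T L -> DTIME T' L.
Proof.
move=> leT [M tfM decM]; exists M => // w; have [hlt out] := decM w.
by rewrite (run_halted (leT _) hlt).
Qed.

(** * Time bounds over the reals and the implications between the statements *)

Section RealBounds.
Variable R : realType.
Local Open Scope ring_scope.
Implicit Types (eps : R) (a l N C : nat).

Lemma ex_nat_gt (x : R) : exists C, x < C%:R.
Proof.
exists (Num.bound `|x|); exact: le_lt_trans (ler_norm x) (archi_boundP (normr_ge0 x)).
Qed.

Lemma log2_ge0 N : 0 <= log2 (N%:R : R).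
Proof.
case: N => [|N]; first by rewrite /log2 ln0 ?mul0r.
by rewrite divr_ge0 ?ln_ge0 ?ler1n.
Qed.

Lemma trunc_log_le_log2 N : (trunc_log 2 N)%:R <= log2 (N%:R : R).
Proof.
have [->|N_gt0] := posnP N; first by rewrite trunc_log0 log2_ge0.
have ln2_gt0 : 0 < ln (2 : R) by rewrite ln_gt0// ltr1n.
rewrite /log2 ler_pdivlMr// mulr_natl -lnXn// ler_ln ?posrE ?exprn_gt0 ?ltr0n//.
by rewrite -natrX ler_nat trunc_logP.
Qed.

Lemma powR_log2 N : (0 < N)%N -> 2 `^ log2 (N%:R : R) = N%:R.
Proof.
move=> N_gt0; have ln2_gt0 : 0 < ln (2 : R) by rewrite ln_gt0// ltr1n.
rewrite /powR pnatr_eq0 /= /log2 divfK ?gt_eqF// lnK// posrE ltr0n//.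
Qed.

(** From m^a <= l follows m^2 <= m^(a eps) <= l^eps. The square leaves room for a constant factor in
    the exponent of the running time. *)
Lemma block_arity_powR a l eps : (1 < a)%N -> (0 < l)%N -> 0 < eps ->
  2 <= a%:R * eps -> (block_arity a l ^ 2)%:R <= l%:R `^ eps :> R.
Proof.
move=> a_gt1 l_gt0 eps_gt0 le2; set m := block_arity a l.
have m_ge1 : 1 <= m%:R :> R by rewrite ler1n expn_gt0.
apply: (@le_trans _ _ ((m ^ a)%:R `^ eps)); last first.
  apply: ge0_ler_powR; rewrite ?nnegrE ?ler0n ?(ltW eps_gt0) ?ler_nat//.
  exact: block_arity_le.
have powE j : (m ^ j)%:R = m%:R `^ j%:R :> R by rewrite natrX powR_mulrn ?ler0n.
by rewrite !powE -powRrM ler_powR.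
Qed.

Lemma block_time_bound a C eps : (1 < a)%N -> 0 < eps -> 2 <= a%:R * eps ->
  exists c : R, forall l, (C * 2 ^ (C * block_arity a l))%:R <= c * 2 `^ (l%:R `^ eps).
Proof.
move=> a_gt1 eps_gt0 le2; exists (C * 2 ^ (C ^ 2 + C))%:R => l.
have two_ge1 : 1 <= 2 :> R by rewrite ler1n.
(* For [l = 0] the arity is 1 although [l ^ eps] is 0, so the leading constant alone must give the
   bound. *)
have [->|l_gt0] := posnP l.
  apply: (@le_trans _ _ (C * 2 ^ (C ^ 2 + C))%:R).
    rewrite /block_arity trunc_log0 expn0 muln1 ler_nat leq_mul2l leq_exp2l//.
    by rewrite leq_addl orbT.
  by rewrite ler_peMr ?ler0n// -[leLHS](powRr0 (2 : R)) ler_powR// powR_ge0.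
set m := block_arity a l.
apply: (@le_trans _ _ (C * 2 ^ (C ^ 2 + C) * 2 ^ (m ^ 2))%:R).
  rewrite ler_nat -mulnA leq_mul2l -expnD leq_exp2l//; apply/orP; right.
  (* The inequality C m <= C^2 + C + m^2 moves the factor C out of the exponent. *)
  by rewrite -!mulnn; nia.
rewrite natrM ler_wpM2l ?ler0n// natrX -powR_mulrn// ler_powR//.
exact: block_arity_powR.
Qed.

Lemma block_time_bound_log2 a C eps : (1 < a)%N -> 0 < eps -> 2 <= a%:R * eps ->
  big_O (fun N => C * 2 ^ (C * block_arity a (trunc_log 2 N)))%N
    (fun N => 2 `^ (log2 (N%:R : R) `^ eps)).
Proof.
move=> a_gt1 eps_gt0 le2.
(* The sign of [c] is unknown, and monotonicity in the exponent needs a nonnegative factor. *)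
have [c le_c] := block_time_bound C a_gt1 eps_gt0 le2; exists `|c| => N.
apply: le_trans (le_c _) _.
apply: (@le_trans _ _ (`|c| * 2 `^ ((trunc_log 2 N)%:R `^ eps))).
  by rewrite ler_wpM2r ?powR_ge0 ?ler_norm.
rewrite ler_wpM2l ?normr_ge0// ler_powR ?ler1n//.
rewrite ge0_ler_powR ?nnegrE ?log2_ge0 ?(ltW eps_gt0)//.
exact: trunc_log_le_log2.
Qed.

Lemma ex_block_exponent eps : 0 < eps -> exists2 a, (1 < a)%N & 2 <= a%:R * eps.
Proof.
move=> eps_gt0; pose b := Num.bound (2 / eps); exists (b + 2)%N; first by rewrite addn2.
rewrite -ler_pdivrMr// natrD ltW//.
have : 2 / eps < b%:R by apply: archi_boundP; rewrite divr_ge0 ?ltW.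
by move=> /lt_le_trans; apply; rewrite lerDl.
Qed.

Lemma samplers_DTIME K eps : has_samplers K -> 0 < eps ->
  natural_proofs_poly (DTIME_O (fun N => 2 `^ (log2 (N%:R : R) `^ eps))) K.
Proof.
move=> smp eps_gt0 c k k_gt0; have [a a_gt1 le2] := ex_block_exponent eps_gt0.
have [Rn [A [C [tfA runA useful dense]]]] :=
  deterministic_property c smp a_gt1 k_gt0.
(* The value 4 leaves at most 2/4 of the functions outside the property. *)
have [n1 dense4] := dense 4; exists Rn, n1; split.
- exists (fun N => C * 2 ^ (C * block_arity a (trunc_log 2 N)))%N.
    exact: block_time_bound_log2.
  exists (A false) => // w; exact: (runA false w [::] w [::] _ _ (leqnn _)).
- move=> n /dense4; have [X0|X_gt0] := posnP #|bfun n|.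
    by move: X0; rewrite card_bfun => /eqP; rewrite expn_eq0.
  move=> dense_n; have -> : (1 / 2%:R = 1 - 1 / 2%:R :> rat)%R by lra.
  by apply: (@Pr_ge_complement _ _ _ 4) => //; lra.
- by move=> n _; exact: useful.
Qed.

(** With [hq] true the machine finds [n] from the length of its oracle. It is deterministic and
    decides [Rn], so it never outputs [None], and [Rn] serves as [S]. *)
Lemma samplers_distinguishers K eps : has_samplers K -> 0 < eps ->
  distinguishers_poly (fun n => 2 `^ (n%:R `^ eps) : R) K.
Proof.
move=> smp eps_gt0 c k k_gt0; have [a a_gt1 le2] := ex_block_exponent eps_gt0.
have [Rn [A [C [tfA runA useful dense]]]] :=
  deterministic_property c smp a_gt1 k_gt0.
pose T n := (C * 2 ^ (C * block_arity a n))%N; exists (A true), T.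
split; first exact: block_time_bound.
have runT n (g : bfun n) r :
    halted (run (A true) (nseq n true) (truth_table g) r (T n)) /\
    output (run (A true) (nseq n true) (truth_table g) r (T n)) = Some (g \in Rn n).
  have [||-> ->] := runA true (nseq n true) (truth_table g) (truth_table g) r (T n).
  - by [].
  - by rewrite size_truth_table trunc_expnK.
  by split=> //; congr Some; apply/asboolP/idP => /property_languageP.
have zero_error n (g : bfun n) :
    zero_error_output (A true) (nseq n true) (truth_table g) (T n) (g \in Rn n).
  split=> [r|]; first by left; have [_ ->] := runT n g r.
  rewrite /Pr (eq_card0 (A := [pred r | _])) ?mul0r// => r.
  by rewrite !inE; have [_ ->] := runT n g r.
split=> [n g r|n g easy|]; first by have [] := runT n g r.
  have gR : (g \in Rn n) = false by apply/negP => /useful/(_ easy).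
  by have := zero_error n g; rewrite gR.
exists Rn; split=> [delta delta_gt0|n f fR]; last by have := zero_error n f; rewrite fR.
pose l := (Num.bound (2 / delta)).+1; have [n1 dense_l] := dense l.
exists n1 => n /dense_l; apply: Pr_ge_complement => //.
  by rewrite card_bfun expn_gt0.
rewrite mulrC -ler_pdivrMr// ltW//.
have : (2 / delta < (Num.bound (2 / delta))%:R)%R.
  by apply: archi_boundP; rewrite divr_ge0 ?ltW.
by move=> /lt_le_trans; apply; rewrite ler_nat.
Qed.

(** For [eps = 1] the time is at most 2^(C+m), and the set of functions on which the distinguisher
    outputs 1 eventually has density at least 1/2. *)
Lemma distinguishers_samplers K :
  (forall eps, 0 < eps -> distinguishers_poly (fun n => 2 `^ (n%:R `^ eps) : R) K) ->
  has_samplers K.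
Proof.
move=> dist_K c k k_gt0; have [A [T [[c0 leT] [hlt easy [S [dense hard]]]]]] :=
  dist_K 1 ltr01 c k k_gt0.
have [n1 dense_half] := dense (1 / 2%:R) isT; have [C ltC] := ex_nat_gt c0.
exists true, A, T, C.+1, n1, S; split.
- move=> m; rewrite -(ler_nat R); apply: le_trans (leT m) _.
  rewrite powRr1 ?ler0n// powR_mulrn ?ler0n//.
  apply: (@le_trans _ _ ((2 ^ C * 2 ^ m)%N%:R)).
    rewrite natrM [X in _ <= _ * X]natrX ler_wpM2r ?exprn_ge0 ?ler0n//.
    by apply: le_trans (ltW ltC) _; rewrite ler_nat; apply/ltnW/ltn_expl.
  by rewrite ler_nat -expnD leq_exp2l// mulSn mulnS; lia.
- move=> m t r _ szt szr; have [g gt] := truth_table_onto szt.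
  by rewrite -gt; exact: (halts_within_size (hlt m g) szr).
- move=> m g r _ szr /easy/zero_error_false; exact.
- move=> m /ltnW/dense_half le_half; apply: Pr_ge_half; apply: le_trans le_half.
  by lra.
- by move=> m g _ /hard/zero_error_true.
Qed.

Lemma DTIME_sub_P L :
  DTIME_O (fun N => 2 `^ (log2 (N%:R : R) `^ 1)) L -> P L.
Proof.
move=> [T [c leT] decT]; have [C ltC] := ex_nat_gt c; exists C.+1.
apply: DTIME_leq decT => N; rewrite -(ler_nat R); apply: le_trans (leT N) _.
rewrite powRr1 ?log2_ge0//.
(* As [ln 0] is 0, the bound at [N = 0] is [c]; the additive constant of the polynomial covers it,
   and likewise for [N = 1]. *)
have [->|N_gt0] := posnP N.
  rewrite /log2 ln0// mul0r powRr0 mulr1 exp0n// add0n ltW// (lt_le_trans ltC)// ler_nat.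
  exact: leqnSn.
rewrite powR_log2//; apply: (@le_trans _ _ (C * N)%:R).
  by rewrite natrM ler_wpM2r ?ler0n ?ltW.
rewrite ler_nat; have [N1|N_gt1] := leqP N 1.
  by rewrite (_ : N = 1%N) ?exp1n; lia.
rewrite expnSr; apply: leq_trans (leq_addr _ _); rewrite leq_mul2r ltnW ?orbT//.
exact: ltn_expl.
Qed.

End RealBounds.

Local Open Scope ring_scope.

Theorem theorem3p8 (R : realType) (K : typical_class) :
  [<-> natural_proofs_poly P K;
       natural_proofs_poly ZPP K;
       forall eps : R, 0 < eps ->
         natural_proofs_poly
           (DTIME_O (fun N : nat => 2 `^ (log2 (N%:R : R) `^ eps))) K;
       forall eps : R, 0 < eps ->
         distinguishers_poly (fun n : nat => 2 `^ (n%:R `^ eps)) K].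
Proof.
have DTIME_P : (forall eps : R, 0 < eps -> natural_proofs_poly
    (DTIME_O (fun N : nat => 2 `^ (log2 (N%:R : R) `^ eps))) K) ->
    natural_proofs_poly P K.
  by move=> /(_ 1 ltr01); apply: natural_proofs_poly_sub; exact: DTIME_sub_P.
have P_ZPP := natural_proofs_poly_sub (K := K) P_sub_ZPP.
tfae.
- exact: P_ZPP.
- by move=> /ZPP_samplers smp eps; exact: samplers_DTIME.
- by move=> /DTIME_P/P_ZPP/ZPP_samplers smp eps; exact: samplers_distinguishers.
- move=> /distinguishers_samplers smp; apply: DTIME_P => eps; exact: samplers_DTIME.
Qed.
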